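(* Let $a\in(0,\infty)$, $1<p\le q<\infty$, $0\le\alpha<d$, and let $(u,v)$ be a pair of weights on $\mathbb{R}^d$. If $$(u,v)\in\mathscr{M}_{p,q,\alpha}^{\,6a+9\sqrt d\,a^2},$$ then $M_\alpha^a$ is bounded from $L^p(\mathbb{R}^d,v,\gamma)$ to $L^q(\mathbb{R}^d,u,\gamma)$; that is, there exists a constant $C>0$ such that for all $f\in L^p(\mathbb{R}^d,v,\gamma)$, $$\left(\int_{\mathbb{R}^d}\big(M_\alpha^a(f)(x)\big)^q u(x)\,d\gamma(x)\right)^{1/q}\le C\left(\int_{\mathbb{R}^d}|f(x)|^p v(x)\,d\gamma(x)\right)^{1/p}.$$
   Context: $\gamma$ is the Gaussian probability measure on $\mathbb{R}^d$, $d\gamma(x)=\pi^{-d/2}e^{-|x|^2}\,dx$, with $|\cdot|$ the Euclidean norm. A weight is a locally integrable function on $\mathbb{R}^d$ that is nonnegative almost everywhere (with respect to $\gamma$). $L^p(\mathbb{R}^d,v,\gamma)$ is the space of measurable $f$ with $\int_{\mathbb{R}^d}|f|^p v\,d\gamma<\infty$, and similarly for $L^q(\mathbb{R}^d,u,\gamma)$. All cubes $Q\subset\mathbb{R}^d$ have sides parallel to the coordinate axes; $c_Q$ is the center and $\ell(Q)$ the side length of $Q$. Put $m(x)=\min\{1,1/|x|\}$ (with $m(0)=1$), and for $b>0$ put $\mathscr{Q}_b=\{Q\subset\mathbb{R}^d \text{ cube}:\ \ell(Q)\le b\,m(c_Q)\}$ and $\mathscr{Q}_b(x)=\{Q\in\mathscr{Q}_b: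 x\in Q\}$. For $b>0$ the local fractional maximal operator is $$M_\alpha^b(f)(x)=\sup_{Q\in\mathscr{Q}_b(x)}\frac{1}{\gamma(Q)^{1-\alpha/d}}\int_Q|f(y)|\,d\gamma(y).$$ Local-$b$ testing condition: for $b\in(0,\infty)$, with $p'=p/(p-1)$ and $\chi_Q$ the characteristic function of $Q$, $(u,v)\in\mathscr{M}_{p,q,\alpha}^b$ means $$\sup_{Q\in\mathscr{Q}_b}\left[\int_Q\big(M_\alpha^b(v^{1-p'}\chi_Q)(x)\big)^q u(x)\,d\gamma(x)\right]^{1/q}\left(\int_Q v(x)^{1-p'}\,d\gamma(x)\right)^{-1/p}<\infty .$$ *)

(* Defs.v *)
From HB Require Import structures.
From mathcomp Require Import all_boot all_order all_algebra.
From mathcomp Require Import all_classical all_reals all_analysis.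
From mathcomp Require Import measurable_realfun.

Set Implicit Arguments.
Unset Strict Implicit.
Unset Printing Implicit Defensive.

Import Order.TTheory GRing.Theory Num.Theory.
Import numFieldNormedType.Exports.

Local Open Scope classical_set_scope.
Local Open Scope ring_scope.

(* R^d is a tuple type because the library puts the product sigma-algebra on
   tuples, but no sigma-algebra on row vectors or finite functions. *)
Notation euclidean R d := (d.-tuple (measurableTypeR R)).

Section lebesgue_cons.
Context (R : realType) (n : nat).
Variable mu : {sigma_finite_measure set (euclidean R n) -> \bar R}.

Definition cons_coord (z : measurableTypeR R * euclidean R n)
  : euclidean R n.+1 := [tuple of z.1 :: z.2].

Lemma measurable_cons_coord : measurable_fun setT cons_coord.
Proof. exact: (measurable_cons measurable_fst measurable_snd). Qed.

Definition lebesgue_cons : set (euclidean R n.+1) -> \bar R :=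
  pushforward (@lebesgue_measure R \x mu)%E cons_coord.

Let lebesgue_cons0 : lebesgue_cons set0 = 0%E.
Proof. by rewrite /lebesgue_cons /pushforward preimage_set0 measure0. Qed.

Let lebesgue_cons_ge0 A : (0 <= lebesgue_cons A)%E.
Proof. by rewrite /lebesgue_cons /pushforward measure_ge0. Qed.

Let lebesgue_cons_semi_sigma_additive : semi_sigma_additive lebesgue_cons.
Proof.
have mc := measurable_cons_coord.
exact: (@measure_semi_sigma_additive _ _ _
  (measure_function_pushforward__canonical__measure_function_Measure _ mc)).
Qed.

HB.instance Definition _ := isMeasure.Build _ _ _ lebesgue_cons
  lebesgue_cons0 lebesgue_cons_ge0 lebesgue_cons_semi_sigma_additive.

Lemma lebesgue_cons_sigma_finite : sigma_finite setT lebesgue_cons.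
Proof.
have [F FT mF] : sigma_finite setT (@lebesgue_measure R \x mu)%E.
  have /sigma_finiteP[F [TF ndF Foo]] := sigma_finiteT (@lebesgue_measure R).
  have /sigma_finiteP[G [TG ndG Goo]] := sigma_finiteT mu.
  exists (fun k => F k `*` G k).
    rewrite -setXTT TF TG predeqE => -[x y]; split.
      move=> [/= [k _ Fkx] [l _ Gly]]; exists (maxn k l) => //; split.
      - by move: x Fkx; exact/subsetPset/ndF/leq_maxl.
      - by move: y Gly; exact/subsetPset/ndG/leq_maxr.
    by move=> [k _ []/= ? ?]; split; exists k.
  move=> k; have [? ?] := Foo k; have [? ?] := Goo k.
  split; first exact: measurableX.
  by rewrite product_measure1E// lte_mul_pinfty// ge0_fin_numE.
pose g (t : euclidean R n.+1) : measurableTypeR R *  euclidean R n :=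
  (tnth t ord0, [tuple of behead t]).
have mg : measurable_fun setT g.
  apply/measurable_fun_pairP; split.
    exact: measurable_tnth.
  exact: measurable_behead.
have gK : cancel cons_coord g.
  by move=> [x t]; congr pair; apply: val_inj.
exists (fun k => g @^-1` F k).
  by rewrite -preimage_bigcup -FT preimage_setT.
move=> k; have [mFk Fk] := mF k; split.
  by rewrite -[X in measurable X]setTI; exact: mg.
rewrite /lebesgue_cons /pushforward -comp_preimage.
by rewrite (_ : _ @^-1` _ = F k)//; apply/seteqP; split=> z /=; rewrite gK.
Qed.

HB.instance Definition _ :=
  Measure_isSigmaFinite.Build _ _ _ lebesgue_cons lebesgue_cons_sigma_finite.

End lebesgue_cons.

(* In dimension 0 the space is a single point, which has measure 1. *)
Fixpoint lebesgueRn (R : realType) (d : nat)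
    : {sigma_finite_measure set (euclidean R d) -> \bar R} :=
  match d with
  | 0%N => \d_([tuple] : euclidean R 0)
  | n.+1 => lebesgue_cons (lebesgueRn R n)
  end.

Section gaussian_space.
Context (R : realType) (d : nat).
Implicit Types (x c : euclidean R d) (Q : set (euclidean R d)).

Definition enorm x : R := Num.sqrt (\sum_(i < d) tnth x i ^+ 2).

Definition gauss_density x : R :=
  pi `^ (- (d%:R / 2)) * expR (- enorm x ^+ 2).

Lemma measurable_coord (i : 'I_d) :
  measurable_fun setT (fun x => tnth x i : R).
Proof. exact: (@measurable_tnth _ (measurableTypeR R) d i). Qed.

Lemma measurable_enorm : measurable_fun setT enorm.
Proof.
apply: (measurableT_comp (f := @Num.sqrt R)).
  exact: (continuous_measurable_fun (@sqrt_continuous R)).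
apply: measurable_sum => i; apply: measurable_funX; exact: measurable_coord.
Qed.

Lemma measurable_gauss_density : measurable_fun setT gauss_density.
Proof.
apply: measurable_funM => //; apply: measurableT_comp => //.
apply: measurableT_comp => //; apply: measurable_funX.
exact: measurable_enorm.
Qed.

Lemma gauss_density_ge0 x : 0 <= gauss_density x.
Proof. by rewrite mulr_ge0 ?powR_ge0 ?expR_ge0. Qed.

Definition gaussian (A : set (euclidean R d)) : \bar R :=
  (\int[lebesgueRn R d]_(x in A) (gauss_density x)%:E)%E.

Let gaussian0 : gaussian set0 = 0%E.
Proof. by rewrite /gaussian integral_set0. Qed.

Let gaussian_ge0 A : (0 <= gaussian A)%E.
Proof.
by apply: integral_ge0 => x _; rewrite lee_fin gauss_density_ge0.
Qed.

Let gaussian_semi_sigma_additive : semi_sigma_additive gaussian.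
Proof.
apply: semi_sigma_additive_nng_induced => [|x].
  by apply/measurable_EFinP; exact: measurable_gauss_density.
by rewrite lee_fin gauss_density_ge0.
Qed.

HB.instance Definition _ := isMeasure.Build _ _ _ gaussian
  gaussian0 gaussian_ge0 gaussian_semi_sigma_additive.

Local Notation gamma := gaussian.

(* Every compact set is contained in a ball centred at the origin. *)
Definition weight (w : euclidean R d -> R) : Prop :=
  [/\ measurable_fun setT w,
      (forall r : R, (lebesgueRn R d).-integrable [set x | enorm x <= r]
                       (EFin \o w)) &
      {ae gamma, forall x, 0 <= w x}].

Definition LpW (p : R) (w f : euclidean R d -> R) : Prop :=
  measurable_fun setT f /\
  (\int[gamma]_x ((`|f x| `^ p * w x)%:E) < +oo)%E.

Definition critical_radius x : R :=
  if enorm x == 0 then 1 else Num.min 1 (enorm x)^-1.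

Definition cube c (l : R) : set (euclidean R d) :=
  [set y : euclidean R d | forall i : 'I_d, `|tnth y i - tnth c i| <= l / 2].

Definition admissible_cubes (b : R) : set (set (euclidean R d)) :=
  [set Q | exists c (l : R),
     [/\ 0 < l, l <= b * critical_radius c & Q = cube c l]].

Definition admissible_cubes_at (b : R) x : set (set (euclidean R d)) :=
  admissible_cubes b `&` [set Q | Q x].

Local Open Scope ereal_scope.

Definition local_maximal (alpha b : R) (f : euclidean R d -> \bar R) x
    : \bar R :=
  ereal_sup [set (gamma Q `^ (1 - alpha / d%:R))^-1 * \int[gamma]_(y in Q) `|f y|
            | Q in admissible_cubes_at b x].

(* v^{1 - p'} for p' = p / (p - 1); as 1 - p' < 0 its value where v vanishes
   is +oo, whereas powR returns 0 there. *)
Definition dual_weight (p : R) (v : euclidean R d -> R) x : \bar R :=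
  if v x == 0%R then +oo else ((v x `^ (1 - p / (p - 1)))%R)%:E.

Definition testing_left (p q alpha b : R) (u v : euclidean R d -> R) Q
    : \bar R :=
  (\int[gamma]_(x in Q)
     (local_maximal alpha b
        (fun y => dual_weight p v y * (\1_Q y)%:E) x `^ q * (u x)%:E)) `^ q^-1.

Definition testing_right (p : R) (v : euclidean R d -> R) Q : \bar R :=
  (\int[gamma]_(x in Q) dual_weight p v x) `^ p^-1.

(* The only indeterminate quotient that occurs is +oo / +oo, and it counts as
   +oo.  With the library's +oo * +oo^-1 = 0 the testing condition would hold
   for v = 0 and u = 1, whereas the maximal operator is not bounded there. *)
Definition testing_quotient (p q alpha b : R) (u v : euclidean R d -> R) Q
    : \bar R :=
  if testing_left p q alpha b u v Q == +oo then +oo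
  else testing_left p q alpha b u v Q * (testing_right p v Q)^-1.

Definition local_testing (p q alpha b : R) (u v : euclidean R d -> R) : Prop :=
  ereal_sup [set testing_quotient p q alpha b u v Q | Q in admissible_cubes b]
    < +oo.

End gaussian_space.

(* Main.v *)
Require Import Defs.
From mathcomp Require Import all_boot all_order all_algebra.
From mathcomp Require Import all_classical all_reals all_analysis.
From mathcomp Require Import measurable_realfun lra ring zify.

Set Implicit Arguments.
Unset Strict Implicit.
Unset Printing Implicit Defensive.

Import Order.TTheory GRing.Theory Num.Theory.

Local Open Scope classical_set_scope.
Local Open Scope ring_scope.

(** The proof follows the scheme of Sawyer's testing theorem.  Write sigma for
    the dual weight [v^(1-p')] and gamma for the Gaussian measure.

    Discretization.  Every admissible cube Q of side l lies in a cube P made of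
    three adjacent cells, in each direction, of a grid of mesh between l / 2 and
    l ([cube_sub_dcube]).  The closure of P is admissible for the larger
    parameter of the testing condition ([dclosure_admissible]), and
    gamma(P) <= C gamma(Q), because the Gaussian density oscillates by a bounded
    factor on admissible cubes ([gaussian_dcube_le]).  Hence the local maximal
    function is dominated by the maximal function over the countably many cubes
    P.  According to residues modulo 3 these split into finitely many colours,
    and cubes of the same colour are nested or disjoint ([dcube_laminar]).

    The finite problem.  By monotone convergence only finite families of one
    colour matter.  Choose disjoint sets E_P inside P on which P attains the
    maximum ([disjoint_argmax]), so that the integral of the [q]-th power of the
    maximal function of f becomes the sum over P of w_P A_P^q, where
      w_P = u(E_P) (gamma(P)^(alpha/d-1) sigma(P))^q
    and A_P is the integral of |f| over P divided by sigma(P).  The testing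
    condition says that the sum of the w_P over the cubes inside P_0 is at most
    K sigma(P_0)^(q/p) for a constant K ([sum_testing_le]).

    The embedding.  Cubes with A_P > t lie in disjoint maximal ones P_i, so their
    total w is at most K times the sum of sigma(P_i)^(q/p).  Since the average
    A_(P_i) exceeds t, sigma(P_i) is at most 2/t times the integral of |f|
    over the part of P_i where |f| > (t/2) sigma ([measure_le_superlevel]).
    Multiplying by t^p and summing over dyadic t produces at each point a
    geometric series, whose sum is of order |f| (|f|/sigma)^(p-1) = |f|^p v
    ([sum_integral_superlevel_le]).  As q/p >= 1, powers of sums dominate sums of
    powers, and the bound by the (q/p)-th power of the integral of |f|^p v
    follows ([carleson_embedding], [laminar_testing_inequality]).

    Where the mass of sigma on an admissible cube is infinite, the testing
    condition forces u to vanish almost everywhere on the cube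
    ([sigma_infinite_weight_null]), so that such cubes contribute nothing. *)

(** * Integrals of non-measurable functions *)

Section integral_without_measurability.
Local Open Scope ereal_scope.
Context {disp : measure_display} {T : measurableType disp} {R : realType}.
Variable mu : {measure set T -> \bar R}.

(** The integral of a nonnegative function is the supremum of the integrals of
    the simple functions below it, hence monotone even for non-measurable
    functions.  The local maximal function is a supremum over uncountably many
    closed cubes; it is handled by comparing it with measurable functions. *)
Lemma ge0_le_integral_nomeas (D : set T) (f g : T -> \bar R) :
  (forall x, D x -> 0 <= f x) -> (forall x, D x -> f x <= g x) ->
  \int[mu]_(x in D) f x <= \int[mu]_(x in D) g x.
Proof.
move=> f0 fg.
rewrite !ge0_integralE//; last by move=> x Dx; exact: le_trans (f0 x Dx) (fg x Dx).
apply: ereal_sup_le => _ [h /= hf <-]; exists h => // x.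
apply: le_trans (hf x) _; rewrite /patch; case: ifPn => // /set_mem Dx.
exact: fg.
Qed.

End integral_without_measurability.

Section ae_nonneg_weight.
Local Open Scope ereal_scope.
Context {disp : measure_display} {T : measurableType disp} {R : realType}.
Variable mu : {measure set T -> \bar R}.

Definition pospart (u : T -> R) (x : T) : \bar R := (Num.max (u x) 0)%:E.

Lemma pospart_ge0 u x : 0 <= pospart u x.
Proof. by rewrite lee_fin le_max lexx orbT. Qed.

Lemma measurable_pospart u : measurable_fun setT u -> measurable_fun setT (pospart u).
Proof. by move=> meas_u; apply/measurable_EFinP; exact: measurable_maxr. Qed.

Lemma mule_pospart (h : \bar R) (u : T -> R) (x : T) : 0 <= h ->
  maxe (h * (u x)%:E) 0 = h * pospart u x.
Proof.
move=> h0; rewrite /pospart; have [u0|u0] := leP 0%R (u x).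
  by rewrite !max_l ?mule_ge0 ?lee_fin.
rewrite !max_r ?mule0 ?(ltW u0)//.
by rewrite mule_ge0_le0// lee_fin ltW.
Qed.

(** A weight may be negative on a null set.  There the negative part of the
    product is at most [+oo] times the indicator of that set, whose integral
    vanishes; this bound is measurable although [h] may not be. *)
Lemma integral_mul_ae_ge0 (D : set T) (h : T -> \bar R) (u : T -> R) :
  measurable D -> measurable_fun setT u -> {ae mu, forall x, (0 <= u x)%R} ->
  (forall x, 0 <= h x) ->
  \int[mu]_(x in D) (h x * (u x)%:E) = \int[mu]_(x in D) (h x * pospart u x).
Proof.
move=> mD meas_u u0 h0.
rewrite integralE [X in _ - X](_ : _ = 0); last first.
  apply/eqP; rewrite eq_le integral_ge0// andbT.
  pose N := [set x | (u x < 0)%R].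
  have mN : measurable N.
    have -> : N = u @^-1` `]-oo, 0%R[%classic.
      by apply/seteqP; split => x /=; rewrite in_itv.
    by rewrite -[X in measurable X]setTI; exact: meas_u.
  have N0 : mu N = 0.
    case: u0 => A [mA A0 uA]; apply: (subset_measure0 mN mA _ A0) => x /= ux.
    by apply: uA => /=; apply/negP; rewrite -ltNge.
  apply: (@le_trans _ _ (\int[mu]_(x in D) ((cst +oo) \_ N) x)).
    apply: ge0_le_integral_nomeas => // x Dx.
    rewrite patchE; case: ifPn => [_|]; first exact: leey.
    rewrite notin_setE /N /= => /negP; rewrite -leNgt => ux.
    by rewrite funenegE max_r// oppe_le0 mule_ge0// lee_fin.
  rewrite -integral_mkcondr integral_cst; last exact: measurableI.
  rewrite (_ : mu (D `&` N) = 0) ?mule0//.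
  by apply: (subset_measure0 _ mN _ N0) => //; exact: measurableI.
rewrite sube0; apply: eq_integral => x _; rewrite funeposE.
exact: mule_pospart.
Qed.

End ae_nonneg_weight.

(** * Powers and geometric sums *)

Section real_lemmas.
Context {R : realType}.

Lemma powR_le (r x y : R) : 0 <= r -> 0 <= x -> x <= y -> x `^ r <= y `^ r.
Proof.
move=> r0 x0 xy; apply: (ge0_ler_powR r0); rewrite ?nnegrE//.
exact: le_trans xy.
Qed.

(** Both summands of [(a + b) * (a + b) `^ (r - 1)] dominate because the
    exponent [r - 1] is nonnegative.  With [r = q / p] this is where the
    relation [p <= q] is used. *)
Lemma powR_superadditive (r a b : R) : 1 <= r -> 0 <= a -> 0 <= b ->
  a `^ r + b `^ r <= (a + b) `^ r.
Proof.
move=> r1 a0 b0; have r0 : 0 < r by exact: lt_le_trans r1.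
rewrite -!(mulr_powRB1 _ r0)//; last exact: addr_ge0.
have r10 : 0 <= r - 1 by rewrite subr_ge0.
by rewrite mulrDl lerD// ler_wpM2l// powR_le// ?lerDl ?lerDr.
Qed.

Lemma sum_powR_le (I : Type) (s : seq I) (P : pred I) (f : I -> R) (r : R) :
  1 <= r -> (forall i, 0 <= f i) ->
  \sum_(i <- s | P i) f i `^ r <= (\sum_(i <- s | P i) f i) `^ r.
Proof.
move=> r1 f0; elim: s => [|i s IH]; first by rewrite !big_nil powR_ge0.
rewrite !big_cons; case: ifP => // _.
apply: le_trans (lerD (lexx _) IH) _.
by apply: powR_superadditive => //; exact: sumr_ge0.
Qed.

(** The sum of a geometric progression is comparable with its largest term.
    With [c] the constant of the statement, [y `^ s = c * (y `^ s - (y / 2) `^ s)],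
    so the sum telescopes. *)
Lemma sum_dyadic_levels_le (s t X : R) (N : nat) : 0 < s -> 0 < t -> 0 <= X ->
  \sum_(k < N | t * 2 ^+ k < X) (t * 2 ^+ k) `^ s
    <= (1 - 2 `^ (- s))^-1 * X `^ s.
Proof.
move=> s0 t0 X0; set c := _^-1.
have h1 : 2 `^ (- s) < 1 :> R.
  rewrite powRN invf_lt1 ?powR_gt0//.
  have := gt0_ltr_powR s0 (x := 1 : R) (y := 2).
  by rewrite powR1; apply; rewrite ?nnegrE ?ltr1n.
have c0 : 0 < c by rewrite invr_gt0 subr_gt0.
have cE : c * 2 `^ (- s) + 1 = c.
  have : c * (1 - 2 `^ (- s)) = 1 by rewrite mulVf// gt_eqF// subr_gt0.
  by rewrite mulrBr mulr1; move: (c * _) => y; lra.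
(* The last level is [t * 2 ^+ N / 2]; truncating at [X] makes the bound
   nondecreasing in [N], so that it survives the steps that add no term. *)
suff H : \sum_(k < N | t * 2 ^+ k < X) (t * 2 ^+ k) `^ s
    <= c * Num.min (t * 2 ^+ N / 2) X `^ s.
  apply: le_trans H _; rewrite ler_pM2l// powR_le ?ge_min ?lexx ?orbT// ?(ltW s0)//.
  by rewrite le_min X0 !mulr_ge0// ltW.
elim: N => [|N IH].
  by rewrite big_ord0 mulr_ge0 ?powR_ge0 ?ltW.
rewrite big_mkcond big_ord_recr -big_mkcond /=.
have -> : t * 2 ^+ N.+1 / 2 = t * 2 ^+ N by rewrite exprSr mulrA mulfK.
have tN0 : 0 < t * 2 ^+ N by rewrite mulr_gt0// exprn_gt0.
case: ifPn => tX.
  apply: le_trans (lerD IH (lexx _)) _.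
  rewrite !min_l ?(ltW tX)//; last first.
    by rewrite ler_pdivrMr// (le_trans (ltW tX))// ler_peMr// ler1n.
  rewrite powRM ?invr_ge0 ?(ltW tN0)// -[2^-1]powR_inv1// -powRrM mulN1r.
  by rewrite mulrCA -[X in _ + X]mulr1 -mulrDr cE mulrC.
rewrite addr0; apply: le_trans IH _.
rewrite ler_pM2l// powR_le ?(ltW s0)//.
  by rewrite le_min X0 !mulr_ge0// ltW.
rewrite le_min !ge_min lexx orbT andbT ler_pdivrMr//.
by rewrite ler_peMr ?ler1n ?(ltW tN0).
Qed.

Lemma exists_dyadic_level (t : R) (N : nat) (x : R) : t < x -> x <= t * 2 ^+ N ->
  exists2 k : 'I_N, t * 2 ^+ k < x & x <= 2 * (t * 2 ^+ k).
Proof.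
move=> tx; elim: N => [|N IH] xN.
  by move: (lt_le_trans tx xN); rewrite expr0 mulr1 ltxx.
have [xN'|xN'] := leP x (t * 2 ^+ N).
  have [k kx xk] := IH xN'; exists (widen_ord (leqnSn N) k) => //.
exists ord_max => //=; apply: le_trans xN _.
by rewrite exprS mulrCA.
Qed.

End real_lemmas.

Section ereal_powers.
Context {R : realType}.
Local Open Scope ereal_scope.
Implicit Types x y : \bar R.

Lemma poweR_le (r : R) x y : (0 <= r)%R -> 0 <= x -> x <= y -> x `^ r <= y `^ r.
Proof.
move=> r0 x0 xy; apply: gt0_ler_poweR => //; rewrite in_itv/= ?x0 ?leey//.
by rewrite (le_trans x0 xy).
Qed.

Lemma poweRVK (r : R) x : (0 < r)%R -> 0 <= x -> (x `^ r^-1) `^ r = x.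
Proof. by move=> r0 x0; rewrite -poweRrM mulVf ?gt_eqF// poweRe1. Qed.

Lemma poweRKV (r : R) x : (0 < r)%R -> 0 <= x -> (x `^ r) `^ r^-1 = x.
Proof. by move=> r0 x0; rewrite -poweRrM mulfV ?gt_eqF// poweRe1. Qed.

(** Taking a positive power and multiplying by a nonnegative number commute with
    suprema; both operations are inverted on the bound. *)
Lemma ereal_sup_powR_mul_le (S : set (\bar R)) (q r : R) (z : \bar R) :
  (0 < q)%R -> (0 <= r)%R -> (forall y, S y -> 0 <= y) -> 0 <= z ->
  (forall y, S y -> y `^ q * r%:E <= z) -> (ereal_sup S) `^ q * r%:E <= z.
Proof.
move=> q0 r0 S0 z0 Sz; have [->|rn0] := eqVneq r 0%R; first by rewrite mule0.
have [->|/set0P[y0 Sy0]] := eqVneq S set0.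
  by rewrite ereal_sup0 poweRNyr ?gt_eqF// mul0e.
have {r0}r0 : (0 < r)%R by rewrite lt_neqAle eq_sym rn0.
rewrite -lee_pdivlMr//.
have zr0 : 0 <= z * r^-1%:E by rewrite mule_ge0// lee_fin invr_ge0 ltW.
rewrite -[leRHS](poweRVK q0)//; apply: poweR_le; first exact: ltW.
  by apply: le_trans (S0 _ Sy0) _; exact: ereal_sup_ubound.
apply: ge_ereal_sup => y Sy; rewrite -[y](poweRKV q0) ?S0//.
apply: poweR_le; rewrite ?invr_ge0 ?(ltW q0) ?poweR_ge0//.
by rewrite lee_pdivlMr// Sz.
Qed.

End ereal_powers.

(** * Laminar families and the Carleson embedding *)

Section laminar.
Context {T : Type} {I : eqType}.
Variable P : I -> set T.

Definition nested_or_disjoint (J : seq I) := {in J &, forall i j,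
  [\/ P i `<=` P j, P j `<=` P i | P i `&` P j = set0]}.

(** The analogue of selecting the maximal dyadic cubes.  The sets are inserted
    one at a time: a new set lies in a chosen one, or else it replaces the
    chosen sets that it contains, and is disjoint from the others. *)
Lemma laminar_cover_disjoint (J : seq I) : nested_or_disjoint J ->
  exists S : seq I, [/\ uniq S, {subset S <= J}, trivIset [set` S] P &
    forall j, j \in J -> exists2 i, i \in S & P j `<=` P i].
Proof.
elim: J => [|a J IH] lamJ; first by exists [::]; split => // i j.
have [|S [uS SJ tS cS]] := IH.
  by move=> i j iJ jJ; apply: lamJ; rewrite inE; [rewrite iJ orbT|rewrite jJ orbT].
have [[i iS Pai]|nS] := pselect (exists2 i, i \in S & P a `<=` P i).
  exists S; split => //; first by move=> j /SJ jJ; rewrite inE jJ orbT.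
  by move=> j; rewrite inE => /orP[/eqP ->|/cS//]; exists i.
pose S' := [seq i <- S | `[< ~ (P i `<=` P a) >]].
have aS : a \notin S by apply/negP => aS; apply: nS; exists a.
exists (a :: S'); split.
- by rewrite /= mem_filter (negPf aS) andbF filter_uniq.
- move=> i; rewrite !inE mem_filter => /orP[->//|/andP[_ /SJ ->]].
  by rewrite orbT.
- have dis i : i \in S' -> P a `&` P i = set0.
    rewrite mem_filter => /andP[/asboolP nia iS].
    have iJ : i \in a :: J by rewrite inE SJ ?orbT.
    have [ai|//|//] := lamJ a i (mem_head _ _) iJ.
    by exfalso; apply: nS; exists i.
  move=> i j /=; rewrite !inE => /orP[/eqP ->|iS'] /orP[/eqP ->|jS']//.
  + by rewrite dis// => -[].
  + by rewrite setIC dis// => -[].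
  + by apply: tS => /=; move: iS' jS'; rewrite !mem_filter => /andP[]? ? /andP[].
- move=> j; rewrite inE => /orP[/eqP ->|/cS[i iS ji]].
    by exists a => //; rewrite mem_head.
  have [ia|nia] := pselect (P i `<=` P a).
    by exists a; rewrite ?mem_head//; exact: subset_trans ji ia.
  by exists i => //; rewrite inE mem_filter iS asboolT ?orbT.
Qed.

End laminar.

Section carleson.
Context {R : realType} {T : Type} {I : eqType}.

Lemma exists_dyadic_range (J : seq I) (A : I -> R) : (forall i, 0 <= A i) ->
  exists2 t : R, 0 < t & exists N, forall j, j \in J -> 0 < A j ->
    t < A j <= t * 2 ^+ N.
Proof.
move=> A0.
have [t t0 tA] : exists2 t : R, 0 < t & forall j, j \in J -> 0 < A j -> t < A j.
  elim: J => [|a J [t t0 tA]]; first by exists 1.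
  have [Aa|Aa] := ltP 0 (A a); last first.
    exists t => // j; rewrite inE => /orP[/eqP -> Aj|]; last exact: tA.
    by move: (lt_le_trans Aj Aa); rewrite ltxx.
  exists (Num.min t (A a / 2)); first by rewrite lt_min t0 divr_gt0.
  move=> j; rewrite inE gt_min => /orP[/eqP -> _|jJ Aj].
    by rewrite ltr_pdivrMr// ltr_pMr// ltr1n orbT.
  by rewrite tA.
exists t => //; set M := \sum_(j <- J) A j.
exists (Num.truncn (M / t)).+1 => j jJ Aj; rewrite tA//=.
have AM : A j <= M by rewrite /M (big_rem j)//= lerDl sumr_ge0.
apply: le_trans AM _; rewrite mulrC -ler_pdivrMr//.
apply: le_trans (ltW (truncnS_gt _)) _.
by rewrite -natrX ler_nat ltnW// ltn_expl.
Qed.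

(** An embedding theorem of Carleson type.  The numbers [A i] are sorted into
    the levels [t * 2 ^+ k].  The sets with [A i] above a level are covered by
    disjoint ones among them, and the Carleson condition bounds the total
    weight [w] below each of these by a power of its mass [s i].  As
    [1 <= q / p], the sum of the powers is at most the power of the sum, which
    the last hypothesis bounds.  In the application [A i] is the average of a
    function and that hypothesis plays the role of the strong type inequality
    for the maximal function. *)
Lemma carleson_embedding (P : I -> set T) (J : seq I) (w s A : I -> R)
    (p q K B : R) : nested_or_disjoint P J ->
  0 < p -> p <= q -> 0 <= K ->
  (forall i, 0 <= w i) -> (forall i, 0 <= s i) -> (forall i, 0 <= A i) ->
  (forall i, i \in J ->
    \sum_(j <- J | `[< P j `<=` P i >]) w j <= K * s i `^ (q / p)) ->
  (forall (t : R) N (S : 'I_N -> seq I), 0 < t ->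
    (forall k, [/\ uniq (S k), {subset S k <= J}, trivIset [set` S k] P &
      forall i, i \in S k -> t * 2 ^+ k < A i]) ->
    \sum_(k < N) (t * 2 ^+ k) `^ p * \sum_(i <- S k) s i <= B) ->
  \sum_(j <- J) w j * A j `^ q <= 2 `^ q * K * B `^ (q / p).
Proof.
move=> lamJ p0 pq K0 w0 s0 A0 carl maxB.
have q0 : 0 < q by exact: lt_le_trans pq.
have [t t0 [N tN]] := exists_dyadic_range J A0.
pose tk k := t * 2 ^+ k.
have tk0 k : 0 <= tk k by rewrite mulr_ge0 ?exprn_ge0// ltW.
have cover (k : 'I_N) : exists S : seq I,
    [/\ uniq S, {subset S <= [seq j <- J | tk k < A j]}, trivIset [set` S] P &
     forall j, j \in [seq j <- J | tk k < A j] -> exists2 i, i \in S & P j `<=` P i].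
  apply: laminar_cover_disjoint => i j; rewrite !mem_filter.
  by move=> /andP[_ iJ] /andP[_ jJ]; exact: lamJ.
have [S HS] := choice cover.
have SB := maxB t N S t0.
have {}SB : \sum_(k < N) tk k `^ p * \sum_(i <- S k) s i <= B.
  apply: SB => k; have [uS SJ tS _] := HS k; split => //.
    by move=> i /SJ; rewrite mem_filter => /andP[].
  by move=> i /SJ; rewrite mem_filter => /andP[].
(* Each positive [A j] is at most twice some level that lies below it. *)
have step1 : \sum_(j <- J) w j * A j `^ q <=
    \sum_(j <- J) \sum_(k < N | tk k < A j) w j * (2 * tk k) `^ q.
  rewrite big_seq [leRHS]big_seq; apply: ler_sum => j jJ.
  have [Aj|Aj] := ltP 0 (A j); last first.
    have -> : A j = 0 by apply/eqP; rewrite eq_le Aj A0.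
    rewrite powR0 ?gt_eqF// mulr0 sumr_ge0// => k _.
    by rewrite mulr_ge0 ?powR_ge0.
  have /andP[tA AN] := tN j jJ Aj.
  have [k kA Ak] := exists_dyadic_level tA AN.
  rewrite (bigD1 k)//=; apply: ler_wpDr.
    by rewrite sumr_ge0// => i _; rewrite mulr_ge0 ?powR_ge0.
  by rewrite ler_wpM2l// powR_le ?(ltW q0).
apply: le_trans step1 _.
rewrite (exchange_big_dep xpredT)//=.
(* Every set above level [k] lies in one of the sets of [S k], so summing the
   Carleson condition over [S k] counts it. *)
have step2 (k : 'I_N) : \sum_(j <- J | tk k < A j) w j <=
   K * \sum_(i <- S k) s i `^ (q / p).
  have [uS SJ tS cS] := HS k.
  have -> : K * \sum_(i <- S k) s i `^ (q / p) =
      \sum_(i <- S k) K * s i `^ (q / p) by rewrite mulr_sumr.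
  apply: (@le_trans _ _ (\sum_(i <- S k) \sum_(j <- J | `[< P j `<=` P i >]) w j)).
    rewrite (exchange_big_dep xpredT)//= big_mkcond big_seq [leRHS]big_seq.
    apply: ler_sum => j jJ; case: ifPn => [tA|_]; last exact: sumr_ge0.
    have [|i iS Pji] := cS j; first by rewrite mem_filter tA.
    by rewrite (big_rem i)//= asboolT//= lerDl sumr_ge0.
  rewrite big_seq [leRHS]big_seq; apply: ler_sum => i /SJ.
  by rewrite mem_filter => /andP[_ /carl].
apply: (@le_trans _ _ (2 `^ q * K * \sum_(k < N) \sum_(i <- S k) (tk k `^ p * s i) `^ (q / p))).
  rewrite mulr_sumr; apply: ler_sum => k _.
  rewrite -mulr_suml powRM//.
  have -> : \sum_(i <- S k) (tk k `^ p * s i) `^ (q / p) =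
     tk k `^ q * \sum_(i <- S k) s i `^ (q / p).
    rewrite mulr_sumr; apply: eq_bigr => i _.
    by rewrite powRM ?powR_ge0// -powRrM mulrCA divff ?gt_eqF// mulr1.
  rewrite [leLHS]mulrC -!mulrA ler_wpM2l ?powR_ge0//.
  by rewrite mulrCA ler_wpM2l ?powR_ge0.
rewrite ler_wpM2l ?mulr_ge0 ?powR_ge0//.
have r1 : 1 <= q / p by rewrite ler_pdivlMr ?mul1r.
have f0 k i : 0 <= tk k `^ p * s i by rewrite mulr_ge0 ?powR_ge0.
apply: (@le_trans _ _ ((\sum_(k < N) tk k `^ p * \sum_(i <- S k) s i) `^ (q / p))); last first.
  rewrite powR_le ?(le_trans _ r1)// sumr_ge0// => k _.
  by rewrite mulr_ge0 ?powR_ge0 ?sumr_ge0.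
apply: le_trans (sum_powR_le _ _ r1 _); last first.
  by move=> k; rewrite mulr_ge0 ?powR_ge0 ?sumr_ge0.
apply: ler_sum => k _; rewrite mulr_sumr; exact: sum_powR_le.
Qed.

End carleson.

(** * The dual weight and truncated weak type estimates *)

Section dual_density.
Context {R : realType}.

(** The value of the dual weight at a point where the weight equals [y]. *)
Definition dual_density (p y : R) : \bar R :=
  if y == 0 then +oo%E else (y `^ (1 - p / (p - 1)))%:E.

Lemma dual_density_gt0 p y : (0 < dual_density p y)%E.
Proof.
rewrite /dual_density; case: ifPn => [_|y0]; first exact: ltry.
rewrite lte_fin; have [yn|yp|y00] := ltgtP y 0.
- by rewrite lt0_powR1.
- exact: powR_gt0.
- by rewrite y00 eqxx in y0.
Qed.

Lemma measurable_dual_density p : measurable_fun setT (dual_density p).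
Proof.
apply: measurable_fun_ifT => //.
- exact: measurable_fun_eqr.
- by apply/measurable_EFinP; exact: measurable_powR.
Qed.

Definition level_const (p : R) : R := 2 `^ p * (1 - 2 `^ (- (p - 1)))^-1.

Lemma level_const_ge0 p : 1 < p -> 0 <= level_const p.
Proof.
move=> p1; rewrite mulr_ge0 ?powR_ge0// invr_ge0 subr_ge0.
rewrite powRN invf_le1 ?powR_gt0//.
have p10 : 0 <= p - 1 by rewrite subr_ge0 ltW.
by have := @powR_le _ (p - 1) 1 2 p10 ler01; rewrite powR1; apply; rewrite ler1n.
Qed.

(** Write [sigma] for the dual density of [y].  The levels that are counted are
    those below [2 F / sigma], so the geometric sum is comparable with
    [(F / sigma) `^ (p - 1)], and [F * (F / sigma) `^ (p - 1) = F `^ p * y]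
    because [sigma `^ (1 - p) = y].  If [y = 0] then [sigma] is infinite and no
    level is counted. *)
Lemma sum_truncated_levels_le (p t y F : R) (N : nat) :
  1 < p -> 0 < t -> 0 <= y -> 0 <= F ->
  \sum_(k < N | ((t * 2 ^+ k / 2)%:E * dual_density p y < F%:E)%E)
     (t * 2 ^+ k) `^ p * (2 / (t * 2 ^+ k)) * F <= level_const p * (F `^ p * y).
Proof.
move=> p1 t0 y0 F0; have p0 : 0 < p by exact: lt_trans p1.
have p10 : 0 < p - 1 by rewrite subr_gt0.
have tk0 k : 0 < t * 2 ^+ k by rewrite mulr_gt0// exprn_gt0.
have [->|yn0] := eqVneq y 0.
  rewrite !mulr0 big_pred0// => k; rewrite /dual_density eqxx gt0_muley; first by rewrite ltNge leey.
  by rewrite lte_fin divr_gt0.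
have {y0}y0 : 0 < y by rewrite lt_neqAle eq_sym yn0.
set e := (p - 1)^-1.
have eE : 1 - p / (p - 1) = - e.
  by rewrite /e; field; rewrite subr_eq0 gt_eqF.
have ye0 : 0 < y `^ e by rewrite powR_gt0.
set X := 2 * (F * y `^ e).
have cond k : ((t * 2 ^+ k / 2)%:E * dual_density p y < F%:E)%E = (t * 2 ^+ k < X).
  rewrite /dual_density (negPf yn0) -EFinM lte_fin eE powRN ltr_pdivrMr// ltr_pdivrMr//.
  by rewrite [F * _ * 2]mulrC.
rewrite (eq_bigl _ _ (fun k : 'I_N => cond k)).
have termE k : (t * 2 ^+ k) `^ p * (2 / (t * 2 ^+ k)) * F =
    2 * F * (t * 2 ^+ k) `^ (p - 1).
  rewrite -(mulr_powRB1 (ltW (tk0 k)) p0).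
  by field; rewrite !gt_eqF ?exprn_gt0.
under eq_bigr do rewrite termE.
rewrite -mulr_sumr.
have X0 : 0 <= X by rewrite !mulr_ge0// ltW.
apply: le_trans (ler_wpM2l _ (sum_dyadic_levels_le N p10 t0 X0)) _.
  by rewrite mulr_ge0.
rewrite /X powRM ?mulr_ge0 ?(ltW ye0)// powRM ?(ltW ye0)// -powRrM.
have -> : e * (p - 1) = 1 by rewrite mulVf// gt_eqF.
rewrite powRr1 ?(ltW y0)// /level_const -(mulr_powRB1 (ltac:(done) : 0 <= 2 :> R) p0).
rewrite -(mulr_powRB1 F0 p0) le_eqVlt; apply/orP; left; apply/eqP.
by ring.
Qed.

End dual_density.

Section truncation.
Local Open Scope ereal_scope.
Context {disp : measure_display} {T : measurableType disp} {R : realType}.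
Variable mu : {measure set T -> \bar R}.
Variables (sigma : T -> \bar R) (F : T -> R).
Hypotheses (msigma : measurable_fun setT sigma) (mF : measurable_fun setT F).
Hypotheses (sigma0 : forall x, 0 <= sigma x) (F0 : forall x, (0 <= F x)%R).

Definition superlevel (t : R) : set T := [set x | (t / 2)%:E * sigma x < (F x)%:E].

Lemma measurable_superlevel t : measurable (superlevel t).
Proof.
rewrite -[superlevel t]setTI; apply: measurable_lte => //.
  exact: measurable_funeM.
exact/measurable_EFinP.
Qed.

(** Off the superlevel set the integrand is at most [t / 2] times [sigma]. *)
Lemma integral_le_superlevel (D : set T) (t : R) : measurable D -> (0 < t)%R ->
  \int[mu]_(x in D) (F x)%:E <=
  (t / 2)%:E * \int[mu]_(x in D) sigma x +
  \int[mu]_(x in D `&` superlevel t) (F x)%:E.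
Proof.
move=> mD t0; have mA := measurable_superlevel t.
have mFE A : measurable_fun A (EFin \o F).
  by apply/measurable_EFinP; exact: measurable_funS mF.
have msA A : measurable_fun A sigma by exact: measurable_funS msigma.
have t20 : (0 <= t / 2)%R by rewrite divr_ge0 ?ltW.
have mDA := measurableI _ _ mD mA; have mDnA := measurableD mD mA.
have -> : \int[mu]_(x in D) (F x)%:E = \int[mu]_(x in D `&` superlevel t) (F x)%:E +
    \int[mu]_(x in D `\` superlevel t) (F x)%:E.
  rewrite -ge0_integral_setU ?setUIDK//.
  - by move=> x _; rewrite lee_fin.
  - by rewrite disj_set2E; apply/eqP; rewrite setDE setIACA setICr setI0.
rewrite addeC leeD2r//.
apply: (@le_trans _ _ (\int[mu]_(x in D `\` superlevel t) ((t / 2)%:E * sigma x))).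
  apply: ge0_le_integral_nomeas => x; first by rewrite lee_fin.
  by move=> [_ /negP]; rewrite -leNgt.
rewrite ge0_integralZl_EFin//. rewrite lee_wpmul2l ?lee_fin//.
by apply: ge0_subset_integral => //; exact: subDsetl.
Qed.

(** If the average of [F] with respect to [sigma] exceeds [t], half of the
    inequality is absorbed by the part of [F] below [t / 2].  This gives the
    truncated weak type estimate for one set; summed over disjoint sets and
    over dyadic levels, it replaces the maximal theorem for [sigma]. *)
Lemma measure_le_superlevel (D : set T) (t : R) : measurable D -> (0 < t)%R ->
  \int[mu]_(x in D) sigma x < +oo ->
  t%:E * \int[mu]_(x in D) sigma x < \int[mu]_(x in D) (F x)%:E ->
  \int[mu]_(x in D) sigma x <=
  (2 / t)%:E * \int[mu]_(x in D `&` superlevel t) (F x)%:E.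
Proof.
move=> mD t0 sfin; move/ltW/le_trans => /(_ _ (integral_le_superlevel mD t0)).
have sge0 : 0 <= \int[mu]_(x in D) sigma x by exact: integral_ge0.
have : 0 <= \int[mu]_(x in D `&` superlevel t) (F x)%:E.
  by apply: integral_ge0 => x _; rewrite lee_fin.
move: sge0 sfin; case: (\int[mu]_(x in D) sigma x) => // s s0 _.
case: (\int[mu]_(x in D `&` superlevel t) (F x)%:E) => [a|_ _|//].
  rewrite -!EFinM -EFinD !lee_fin => a0 h.
  rewrite mulrAC ler_pdivlMr//; nra.
by rewrite gt0_muley ?leey// lte_fin divr_gt0.
Qed.

End truncation.

Section weighted_truncation.
Local Open Scope ereal_scope.
Context {disp : measure_display} {T : measurableType disp} {R : realType}.
Variable mu : {measure set T -> \bar R}.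
Variables (p : R) (v F : T -> R).
Hypotheses (p1 : (1 < p)%R) (mv : measurable_fun setT v).
Hypothesis v0 : {ae mu, forall x, (0 <= v x)%R}.
Hypotheses (mF : measurable_fun setT F) (F0 : forall x, (0 <= F x)%R).

Lemma measurable_dual_density_comp : measurable_fun setT (dual_density p \o v).
Proof. exact: measurableT_comp (measurable_dual_density p) mv. Qed.

Lemma sum_integral_superlevel_le (t : R) (N : nat) (D : 'I_N -> set T) :
  (forall k, measurable (D k)) -> (0 < t)%R ->
  \sum_(k < N) ((t * 2 ^+ k) `^ p * (2 / (t * 2 ^+ k)))%:E *
     \int[mu]_(x in D k `&` superlevel (dual_density p \o v) F (t * 2 ^+ k)) (F x)%:E <=
  (level_const p)%:E * \int[mu]_x (F x `^ p * v x)%:E.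
Proof.
move=> mD t0; have ms := measurable_dual_density_comp.
pose c k : R := ((t * 2 ^+ k) `^ p * (2 / (t * 2 ^+ k)))%R.
have tk0 k : (0 < t * 2 ^+ k)%R by rewrite mulr_gt0// exprn_gt0.
have c0 k : (0 <= c k)%R by rewrite mulr_ge0 ?powR_ge0// divr_ge0// ltW.
pose A (k : 'I_N) := D k `&` superlevel (dual_density p \o v) F (t * 2 ^+ k).
have mA k : measurable (A k) by apply: measurableI => //; exact: measurable_superlevel.
pose vp x := Num.max (v x) 0%R.
have mvp : measurable_fun setT vp by exact: measurable_maxr.
have mFp : measurable_fun setT (fun x => F x `^ p)%R.
  exact: measurableT_comp (measurable_powR _) mF.
have mFE B : measurable_fun B (EFin \o F).
  by apply/measurable_EFinP; exact: measurable_funS mF.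
have -> : \int[mu]_x (F x `^ p * v x)%:E = \int[mu]_x (F x `^ p * vp x)%:E.
  apply: ae_eq_integral => //.
  - by apply/measurable_EFinP; exact: measurable_funM.
  - by apply/measurable_EFinP; exact: measurable_funM.
  - apply: filterS v0 => x vx _; congr (_ * _)%:E.
    by rewrite /vp max_l.
have mt (k : 'I_N) : measurable_fun setT (fun x => (c k)%:E * ((EFin \o F) \_ (A k)) x).
  by apply: measurable_funeM; apply/(measurable_restrictT _ (mA k)).
have F0' (k : 'I_N) x : 0 <= ((EFin \o F) \_ (A k)) x.
  by apply: erestrict_ge0 => y _; rewrite lee_fin.
rewrite [leLHS](_ : _ = \sum_(k < N)
    \int[mu]_x ((c k)%:E * ((EFin \o F) \_ (A k)) x)); last first.
  apply: eq_bigr => k _; rewrite ge0_integralZl_EFin//; last first.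
    exact/(measurable_restrictT _ (mA k)).
  by rewrite integral_mkcond.
rewrite -ge0_integral_sum//; last by move=> k x _; rewrite mule_ge0 ?lee_fin.
rewrite -ge0_integralZl_EFin ?level_const_ge0//; last 2 first.
- by move=> x _; rewrite lee_fin mulr_ge0 ?powR_ge0// le_max lexx orbT.
- by apply/measurable_EFinP; exact: measurable_funM.
apply: ae_ge0_le_integral => //.
- by move=> x _; apply: sume_ge0 => k _; rewrite mule_ge0 ?lee_fin.
- exact: emeasurable_sum.
- move=> x _; rewrite -EFinM lee_fin mulr_ge0 ?level_const_ge0//.
  by rewrite mulr_ge0 ?powR_ge0// le_max lexx orbT.
- by apply: measurable_funeM; apply/measurable_EFinP; exact: measurable_funM.
apply: filterS v0 => x vx _; rewrite /vp max_l//.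
apply: le_trans (_ : _ <= (\sum_(k < N |
  ((t * 2 ^+ k / 2)%:E * dual_density p (v x) < (F x)%:E)%E) c k * F x)%:E) _; last first.
  by rewrite -EFinM lee_fin sum_truncated_levels_le.
rewrite -sumEFin [leRHS]big_mkcond; apply: lee_sum => k _.
rewrite /= patchE; case: ifPn => [/set_mem[_ /= ->]|_]; first by rewrite EFinM.
by rewrite mule0; case: ifPn => // _; rewrite lee_fin mulr_ge0.
Qed.

End weighted_truncation.

(** * The testing inequality for finite laminar families *)

Section linearization.
Context {disp : measure_display} {T : measurableType disp} {R : realType}.
Context {I : choiceType}.
Variable P : I -> set T.
Hypothesis mP : forall i, measurable (P i).

(** Linearization of a finite maximum: [E i] consists of points of [P i] at
    which the constant [c i] is the largest one among the sets through the
    point.  A new set [P a] claims all its points, except those that belong to a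
    constant at least as large as [c a]. *)
Lemma disjoint_argmax (c : I -> \bar R) (J : seq I) : exists E : I -> set T,
  [/\ forall i, measurable (E i), forall i, E i `<=` P i,
      forall i j x, i \in J -> j \in J -> E i x -> E j x -> i = j &
      forall j x, j \in J -> P j x -> exists i, [/\ i \in J, E i x & (c j <= c i)%E]].
Proof.
elim: J => [|a J [E [mE EP dE cE]]].
  by exists (fun=> set0); split => // i x [].
have [aJ|aJ] := boolP (a \in J).
  exists E; split => //.
    move=> i j x iJ jJ; apply: dE.
      by move: iJ; rewrite inE => /orP[/eqP ->|].
    by move: jJ; rewrite inE => /orP[/eqP ->|].
  move=> j x; rewrite inE => /orP[/eqP ->|jJ] Pj.
    by have [i [iJ Ei ci]] := cE a x aJ Pj; exists i; rewrite inE iJ orbT.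
  by have [i [iJ Ei ci]] := cE j x jJ Pj; exists i; rewrite inE iJ orbT.
pose big := \big[setU/set0]_(i <- J | (c a <= c i)%E) E i.
have bigE x : big x <-> exists i, [/\ i \in J, (c a <= c i)%E & E i x].
  rewrite /big -bigcup_seq_cond; split.
    by move=> [i /= /andP[iJ ci] Ei]; exists i.
  by move=> [i [iJ ci Ei]]; exists i => //=; rewrite iJ.
pose E' i := if i == a then P a `\` big
             else if (c a <= c i)%E then E i else E i `\` P a.
have EaE x : E' a x <-> P a x /\ ~ big x by rewrite /E' eqxx.
have EiE i x : i \in J -> E' i x <-> E i x /\ (c a <= c i)%E \/ E i x /\ ~ P a x.
  move=> iJ; have ia : i != a by apply: contraNneq aJ => <-.
  rewrite /E' (negPf ia); case: ifPn => ci; last by split; [right|case=> -[]].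
  by split; [left|case=> -[]].
exists E'; split.
- move=> i; rewrite /E'; case: ifP => _; last by case: ifP => _ //; exact: measurableD.
  by apply: measurableD => //; exact: bigsetU_measurable.
- move=> i x; rewrite /E'; case: ifPn => [/eqP -> []//|_].
  by case: ifPn => _; [exact: EP|case=> + _; exact: EP].
- have dEa j x : j \in J -> E' a x -> E' j x -> False.
    move=> jJ /EaE[Pa nb] /(EiE _ _ jJ)[[Ej cj]|[_ nPa]//].
    by apply: nb; apply/bigE; exists j.
  have EjE j x : j \in J -> E' j x -> E j x.
    by move=> jJ /(EiE _ _ jJ)[[]|[]].
  move=> i j x; rewrite !inE => /orP[/eqP ->|iJ] /orP[/eqP ->|jJ]//.
  + by move=> Ea Ej; case: (dEa j x).
  + by move=> Ea Ej; case: (dEa i x).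
  + by move=> /(EjE _ _ iJ) Ei /(EjE _ _ jJ) Ej; exact: dE Ei Ej.
- have main y x : P a x -> (y <= c a)%E -> exists i, [/\ i \in a :: J, E' i x & (y <= c i)%E].
    move=> Pa ya; have [/bigE[i [iJ ci Ei]]|nb] := pselect (big x).
      exists i; split; first by rewrite inE iJ orbT.
        by apply/EiE => //; left.
      exact: le_trans ci.
    by exists a; split => //; [exact: mem_head|exact/EaE].
  move=> j x; rewrite inE => /orP[/eqP -> Pa|jJ Pj]; first exact: main.
  have [i [iJ Ei ci]] := cE j x jJ Pj.
  have [Pa|nPa] := pselect (P a x); last first.
    exists i; split => //; first by rewrite inE iJ orbT.
    by apply/EiE => //; right.
  have [cai|cai] := leP (c a) (c i); last first.
    by apply: main => //; exact: le_trans (ltW cai).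
  exists i; split => //; first by rewrite inE iJ orbT.
  by apply/EiE => //; left.
Qed.

End linearization.

Section laminar_testing_inequality.
Local Open Scope ereal_scope.
Context {disp : measure_display} {T : measurableType disp} {R : realType}.
Variable mu : {measure set T -> \bar R}.
Context {I : choiceType}.
Variables (P : I -> set T) (J : seq I).
Hypotheses (mP : forall i, measurable (P i)) (lamJ : nested_or_disjoint P J).
Variables (p q K : R) (theta : I -> R) (u : T -> \bar R) (v F : T -> R).
Hypotheses (p1 : (1 < p)%R) (pq : (p <= q)%R) (K0 : (0 <= K)%R).
Hypotheses (theta0 : forall i, (0 <= theta i)%R).
Hypotheses (meas_u : measurable_fun setT u) (u0 : forall x, 0 <= u x).
Hypotheses (mv : measurable_fun setT v) (v0 : {ae mu, forall x, (0 <= v x)%R}).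
Hypotheses (mF : measurable_fun setT F) (F0 : forall x, (0 <= F x)%R).

Let sigma A := \int[mu]_(x in A) dual_density p (v x).

(** The testing argument for a finite laminar family.  With
    [w j = (theta j * sigma (P j)) `^ q * u (E j)] and [A j] the average of [F]
    over [P j] with respect to [sigma], the left-hand side is the sum of the
    [w j * A j `^ q].  The fifth hypothesis says that [w] is a Carleson
    sequence, so [carleson_embedding] applies; its last hypothesis follows from
    the truncated estimates.  Sets of infinite dual mass carry no mass of [u]
    and drop out. *)
Lemma laminar_testing_inequality (E : I -> set T) :
  (forall i, measurable (E i)) -> (forall i, E i `<=` P i) ->
  (forall i, i \in J -> 0 < sigma (P i)) ->
  (forall i, i \in J -> sigma (P i) = +oo -> \int[mu]_(x in P i) u x = 0) ->
  (forall i, i \in J -> sigma (P i) < +oo ->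
     \sum_(j <- J | `[< P j `<=` P i >])
       ((theta j)%:E * sigma (P j)) `^ q * \int[mu]_(x in E j) u x
     <= K%:E * sigma (P i) `^ (q / p)) ->
  \int[mu]_x (F x `^ p * v x)%:E < +oo ->
  \sum_(j <- J) ((theta j)%:E * \int[mu]_(x in P j) (F x)%:E) `^ q *
     \int[mu]_(x in E j) u x <=
  (2 `^ q * K * level_const p `^ (q / p))%:E *
     (\int[mu]_x (F x `^ p * v x)%:E) `^ (q / p).
Proof.
move=> mE EP sgt0 soo carl Ffin.
have p0 : (0 < p)%R by exact: lt_trans p1.
have q0 : (0 < q)%R by exact: lt_le_trans pq.
have s0 A : 0 <= sigma A by apply: integral_ge0 => x _; exact/ltW/dual_density_gt0.
have U0 A : 0 <= \int[mu]_(x in A) u x by exact: integral_ge0.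
set X := \int[mu]_x (F x `^ p * v x)%:E in Ffin *.
have XE : X = \int[mu]_x (F x `^ p * Num.max (v x) 0)%:E.
  have mFp : measurable_fun setT (fun x => F x `^ p)%R.
    exact: measurableT_comp (measurable_powR _) mF.
  apply: ae_eq_integral => //.
  - by apply/measurable_EFinP; exact: measurable_funM.
  - by apply/measurable_EFinP; apply: measurable_funM => //; exact: measurable_maxr.
  - by apply: filterS v0 => x vx _; rewrite max_l.
have X0 : 0 <= X.
  rewrite XE; apply: integral_ge0 => x _.
  by rewrite lee_fin mulr_ge0 ?powR_ge0// le_max lexx orbT.
have Xf : X \is a fin_num by rewrite ge0_fin_numE.
pose J' := [seq j <- J | sigma (P j) < +oo].
have J'J j : j \in J' -> j \in J by rewrite mem_filter => /andP[].
have sf j : j \in J' -> sigma (P j) \is a fin_num.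
  by rewrite mem_filter ge0_fin_numE// => /andP[].
have mab t : measurable (superlevel (dual_density p \o v) F t).
  by apply: measurable_superlevel => //; exact: measurable_dual_density_comp.
have mFE A : measurable_fun A (EFin \o F).
  by apply/measurable_EFinP; exact: measurable_funS mF.
pose G j : \bar R := \int[mu]_(x in P j) (F x)%:E.
have G0 j : 0 <= G j by apply: integral_ge0 => x _; rewrite lee_fin.
(* Finiteness of the integral of [F]: at level 1 it is at most half the mass of
   [sigma] plus the integral over the superlevel set, which is controlled by
   the weighted norm of [F]. *)
have Gf j : j \in J' -> G j \is a fin_num.
  move=> jJ; rewrite ge0_fin_numE//.
  have ds0 x : 0 <= (dual_density p \o v) x by exact/ltW/dual_density_gt0.
  have h1 := integral_le_superlevel mu (measurable_dual_density_comp p mv) mF ds0 F0 (mP j) (ltr01 : (0 < 1 :> R)%R).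
  apply: le_lt_trans h1 _.
  apply: lte_add_pinfty.
    by rewrite lte_mul_pinfty ?lee_fin// ltey_eq sf.
  have := sum_integral_superlevel_le (mu:=mu) p1 mv v0 mF F0 (t := 1%R) (N := 1%N) (D := fun=> P j).
  rewrite big_ord_recl big_ord0 adde0 expr0 mulr1 powR1 mul1r divr1.
  move=> /(_ (fun=> mP j) ltr01) h.
  have : 2%:E * \int[mu]_(x in P j `&` superlevel (dual_density p \o v) F 1) (F x)%:E < +oo.
    by apply: le_lt_trans h _; rewrite lte_mul_pinfty// lee_fin level_const_ge0.
  case: (\int[mu]_(x in _) _) => //; first by move=> r _; exact: ltry.
  by rewrite gt0_muley ?lte_fin.
have Uf j : j \in J' -> ((theta j)%:E * sigma (P j)) `^ q * \int[mu]_(x in E j) u x \is a fin_num.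
  move=> jJ; have jJ' := J'J _ jJ.
  have t0 i : 0 <= ((theta i)%:E * sigma (P i)) `^ q * \int[mu]_(x in E i) u x.
    by rewrite mule_ge0 ?poweR_ge0.
  rewrite ge0_fin_numE//.
  apply: (@le_lt_trans _ _ (K%:E * sigma (P j) `^ (q / p))); last first.
    by rewrite lte_mul_pinfty ?lee_fin// poweR_lty// ltey_eq sf.
  apply: le_trans (carl j jJ' _); last by rewrite ltey_eq sf.
  rewrite (big_rem j)//= asboolT//; apply: leeDl; exact: sume_ge0.
pose w j := fine (((theta j)%:E * sigma (P j)) `^ q * \int[mu]_(x in E j) u x).
pose s j := fine (sigma (P j)).
pose A j := (fine (G j) / s j)%R.
have w0 j : (0 <= w j)%R by rewrite fine_ge0// mule_ge0 ?poweR_ge0.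
have s0' j : (0 <= s j)%R by rewrite fine_ge0.
have A0 j : (0 <= A j)%R by rewrite divr_ge0// fine_ge0.
have sE j : j \in J' -> sigma (P j) = (s j)%:E by move=> jJ; rewrite fineK ?sf.
have carl' i : i \in J' ->
    (\sum_(j <- J' | `[< P j `<=` P i >]) w j <= K * s i `^ (q / p))%R.
  move=> iJ; rewrite -lee_fin EFinM -poweR_EFin -sE//.
  apply: le_trans (carl i (J'J _ iJ) _); last by rewrite ltey_eq sf.
  rewrite -sumEFin big_filter_cond.
  rewrite [leLHS](_ : _ = \sum_(j <- J | (sigma (P j) < +oo) && `[< P j `<=` P i >])
    (((theta j)%:E * sigma (P j)) `^ q * \int[mu]_(x in E j) u x)); last first.
    rewrite big_seq_cond [RHS]big_seq_cond; apply: eq_bigr => j /andP[jJ /andP[js _]].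
    by rewrite fineK// Uf// mem_filter js.
  apply: lee_sum_nneg_subset; first by move=> j /andP[_].
  by move=> j _; rewrite mule_ge0 ?poweR_ge0.
(* The sets of one level are disjoint, so their truncated estimates add up to
   an integral over the union. *)
have maxB (t : R) N (S : 'I_N -> seq I) : (0 < t)%R ->
    (forall k, [/\ uniq (S k), {subset S k <= J'}, trivIset [set` S k] P &
      forall i, i \in S k -> t * 2 ^+ k < A i]%R) ->
    (\sum_(k < N) (t * 2 ^+ k) `^ p * \sum_(i <- S k) s i <= level_const p * fine X)%R.
  move=> t0 HS; rewrite -lee_fin EFinM fineK//.
  pose D (k : 'I_N) := \big[setU/set0]_(i <- S k) P i.
  have mD k : measurable (D k) by exact: bigsetU_measurable.
  apply: le_trans (sum_integral_superlevel_le p1 mv v0 mF F0 mD t0).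
  rewrite -sumEFin; apply: lee_sum => k _.
  have [uS SJ tS AS] := HS k.
  have tk0 : (0 < t * 2 ^+ k)%R by rewrite mulr_gt0// exprn_gt0.
  rewrite EFinM [X in _ <= X * _]EFinM -muleA lee_wpmul2l ?lee_fin ?powR_ge0//.
  rewrite -sumEFin /D big_distrl/= ge0_integral_bigsetU//; last 3 first.
  - by move=> i; exact: measurableI.
  - exact: trivIset_setIr.
  - by move=> x _; rewrite lee_fin.
  rewrite ge0_sume_distrr; last first.
    by move=> i _; apply: integral_ge0 => x _; rewrite lee_fin.
  rewrite big_seq [leRHS]big_seq; apply: lee_sum => i iS.
  rewrite -sE ?SJ//; apply: measure_le_superlevel => //.
  - exact: measurable_dual_density_comp.
  - by move=> x; exact/ltW/dual_density_gt0.
  - by rewrite -/(sigma _) ltey_eq sf ?SJ.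
  - have iJ := SJ _ iS; rewrite -/(sigma _) -/(G _) sE// -[G i]fineK ?Gf//.
    have := AS i iS; rewrite /A ltr_pdivlMr -?EFinM ?lte_fin// -lte_fin -sE//.
    by apply: sgt0; exact: J'J.
have lamJ' : nested_or_disjoint P J'.
  by move=> i j /J'J iJ /J'J jJ; exact: lamJ.
have := carleson_embedding lamJ' p0 pq K0 w0 s0' A0 carl' maxB.
rewrite -lee_fin powRM ?fine_ge0 ?level_const_ge0//.
rewrite mulrA EFinM -[(fine X `^ _)%:E]poweR_EFin fineK//.
apply: le_trans.
rewrite -sumEFin /J' big_filter.
rewrite [leRHS]big_mkcond [leLHS]big_seq [leRHS]big_seq.
apply: lee_sum => j jJ; case: ifPn => [sj|].
  have jJ' : j \in J' by rewrite mem_filter sj.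
  have sj0 : (0 < s j)%R by rewrite -lte_fin -sE// sgt0.
  rewrite -/(G j) -[G j]fineK ?Gf//.
  have -> : (fine (G j) = A j * s j)%R by rewrite /A divfK// gt_eqF.
  rewrite EFinM muleCA -sE// poweRM ?lee_fin//; last by rewrite mule_ge0 ?lee_fin.
  by rewrite [leRHS]EFinM [leRHS]muleC /w fineK ?Uf// -muleA.
rewrite -leNgt leye_eq => /eqP sj.
have : \int[mu]_(x in E j) u x <= 0.
  rewrite -(soo j jJ sj); apply: ge0_subset_integral => //.
  exact: measurable_funS meas_u.
by move=> h; rewrite (_ : \int[mu]_(x in E j) u x = 0) ?mule0//; apply/eqP; rewrite eq_le h U0.
Qed.

End laminar_testing_inequality.

(** * Maxima over finite and countable families *)

Section finite_maximal.
Local Open Scope ereal_scope.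
Context {disp : measure_display} {T : measurableType disp} {R : realType}.
Context {I : choiceType}.
Variable mu : {measure set T -> \bar R}.

Variables (P : I -> set T) (c : I -> \bar R) (w : T -> \bar R).
Hypotheses (mP : forall i, measurable (P i)) (c0 : forall i, 0 <= c i).
Hypotheses (mw : measurable_fun setT w) (w0 : forall x, 0 <= w x).

Definition finite_max (J : seq I) (x : T) : \bar R :=
  \big[maxe/0]_(i <- J) (c i * (w \_ (P i)) x).

Let w0' i x : 0 <= (w \_ (P i)) x.
Proof. by apply: erestrict_ge0 => y _. Qed.

Lemma finite_max_ge0 J x : 0 <= finite_max J x.
Proof.
rewrite /finite_max; elim: J => [|i J IH]; first by rewrite big_nil.
by rewrite big_cons le_max IH orbT.
Qed.

Lemma le_finite_max J i x : i \in J -> P i x -> c i * w x <= finite_max J x.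
Proof.
rewrite /finite_max => + Px; elim: J => // k J IH; rewrite inE big_cons le_max.
by case/orP => [/eqP <-|/IH ->]; rewrite ?orbT// patchE mem_set// lexx.
Qed.

Lemma finite_max_le J x z : 0 <= z ->
  (forall i, i \in J -> P i x -> c i * w x <= z) -> finite_max J x <= z.
Proof.
rewrite /finite_max => z0 Jz; elim: J Jz => [|k J IH] Jz; first by rewrite big_nil.
rewrite big_cons ge_max IH ?andbT; last first.
  by move=> i iJ; apply: Jz; rewrite inE iJ orbT.
rewrite patchE; case: ifPn => [/set_mem|_]; last by rewrite mule0.
by apply: Jz; rewrite mem_head.
Qed.

Lemma measurable_finite_max J : measurable_fun setT (finite_max J).
Proof.
rewrite /finite_max; elim: J => [|i J IH].
  by under eq_fun do rewrite big_nil; exact: measurable_cst.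
under eq_fun do rewrite big_cons.
apply: measurable_maxe => //; apply: measurable_funeM.
by apply/(measurable_restrictT _ (mP i)); exact: measurable_funS mw.
Qed.

(** At each point the maximum is attained by the set [E i] of [disjoint_argmax]
    through that point. *)
Lemma integral_finite_max_le (J : seq I) : exists E : I -> set T,
  [/\ forall i, measurable (E i), forall i, E i `<=` P i,
      forall i j x, i \in J -> j \in J -> E i x -> E j x -> i = j &
      \int[mu]_x finite_max J x <= \sum_(i <- J) c i * \int[mu]_(x in E i) w x].
Proof.
have [E [mE EP dE cE]] := disjoint_argmax mP c J.
exists E; split => //.
have mwE i : measurable_fun setT (w \_ (E i)).
  by apply/(measurable_restrictT _ (mE i)); exact: measurable_funS mw.
have wE0 i x : 0 <= (w \_ (E i)) x by apply: erestrict_ge0 => y _.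
rewrite [leRHS](_ : _ = \sum_(i <- J) \int[mu]_x (c i * (w \_ (E i)) x)); last first.
  by apply: eq_bigr => i _; rewrite ge0_integralZl// integral_mkcond.
rewrite -ge0_integral_sum//; last 2 first.
- by move=> i; exact: measurable_funeM.
- by move=> i x _; rewrite mule_ge0.
apply: ge0_le_integral_nomeas => x _; first exact: finite_max_ge0.
apply: finite_max_le.
  by apply: sume_ge0 => i _; rewrite mule_ge0.
move=> i iJ Pix; have [k [kJ Ek ck]] := cE i x iJ Pix.
rewrite (big_rem k)//=; apply: le_trans (leeDl _ _); last first.
  by apply: sume_ge0 => j _; rewrite mule_ge0.
by rewrite patchE mem_set// lee_wpmul2r.
Qed.

End finite_maximal.

Section countable_maximal.
Local Open Scope ereal_scope.
Context {disp : measure_display} {T : measurableType disp} {R : realType}.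
Context {I : countType}.
Variable mu : {measure set T -> \bar R}.
Variables (P : I -> set T) (c : I -> \bar R) (w : T -> \bar R).
Hypotheses (mP : forall i, measurable (P i)) (c0 : forall i, 0 <= c i).
Hypotheses (mw : measurable_fun setT w) (w0 : forall x, 0 <= w x).
Variable (A : {pred I}).

(** An exhaustion of the countable set [A] by finite lists, so that the maxima
    over the lists increase to the maximum over [A]. *)
Definition initial_segment (n : nat) : seq I :=
  [seq i <- pmap (@pickle_inv I) (iota 0 n) | A i].

Lemma uniq_initial_segment n : uniq (initial_segment n).
Proof.
rewrite filter_uniq//; apply: (@pmap_uniq _ _ _ pickle); last exact: iota_uniq.
exact: pickle_invK.
Qed.

Lemma mem_initial_segment i : A i -> exists n, i \in initial_segment n.
Proof.
move=> Ai; exists (pickle i).+1; rewrite mem_filter Ai mem_pmap.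
by apply/mapP; exists (pickle i); rewrite ?pickleK_inv// mem_iota/=.
Qed.

Lemma sub_initial_segment m n : (m <= n)%N -> {subset initial_segment m <= initial_segment n}.
Proof.
move=> mn i; rewrite !mem_filter => /andP[-> /=].
rewrite !mem_pmap => /mapP[k km ->]; apply/mapP; exists k => //.
by move: km; rewrite !mem_iota/= !add0n => /leq_trans; exact.
Qed.

Lemma nd_finite_max x : nondecreasing_seq (fun n => finite_max P c w (initial_segment n) x).
Proof.
move=> m n mn; apply: finite_max_le => //; first exact: finite_max_ge0.
by move=> i im; apply: le_finite_max => //; exact: sub_initial_segment im.
Qed.

Definition countable_max (x : T) : \bar R :=
  limn (fun n => finite_max P c w (initial_segment n) x).

Lemma countable_max_ge0 x : 0 <= countable_max x.
Proof.
apply: lime_ge; first exact: ereal_nondecreasing_is_cvgn (nd_finite_max x).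
by apply: nearW => n; exact: finite_max_ge0.
Qed.

Lemma le_countable_max i x : A i -> P i x -> c i * w x <= countable_max x.
Proof.
move=> Ai Pix; have [n iN] := mem_initial_segment Ai.
apply: le_trans (le_finite_max c w iN Pix) _.
apply: lime_ge; first exact: ereal_nondecreasing_is_cvgn (nd_finite_max x).
near=> m; apply: nd_finite_max; near: m; exact: nbhs_infty_ge.
Unshelve. all: by end_near. Qed.

Lemma measurable_countable_max : measurable_fun setT countable_max.
Proof.
apply: (emeasurable_fun_cvg (fun n => finite_max P c w (initial_segment n))).
  by move=> n; exact: measurable_finite_max.
by move=> x _; exact: ereal_nondecreasing_is_cvgn (nd_finite_max x).
Qed.

Lemma integral_countable_max_le (B : \bar R) :
  (forall n, \int[mu]_x finite_max P c w (initial_segment n) x <= B) ->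
  \int[mu]_x countable_max x <= B.
Proof.
move=> HB; rewrite monotone_convergence//; last 3 first.
- by move=> n; exact: measurable_finite_max.
- by move=> n x _; exact: finite_max_ge0.
- by move=> x _; exact: nd_finite_max.
apply: lime_le; last by apply: nearW.
apply: ereal_nondecreasing_is_cvgn => m n mn.
by apply: ge0_le_integral_nomeas => x _; [exact: finite_max_ge0|exact: nd_finite_max].
Qed.

End countable_maximal.

(** * Boxes, the Euclidean norm and the Gaussian density *)

Section boxes.
Context {R : realType}.

Definition box d (A : 'I_d -> set R) : set (euclidean R d) :=
  [set x | forall i, A i (tnth x i)].

Lemma measurable_box d (A : 'I_d -> set R) :
  (forall i, measurable (A i)) -> measurable (box A).
Proof.
move=> mA; rewrite (_ : box A =
    \big[setI/setT]_(i < d) ((fun x : euclidean R d => tnth x i : R) @^-1` A i)).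
  apply: bigsetI_measurable => i _; rewrite -[X in measurable X]setTI.
  by apply: (@measurable_coord R d i) => //.
apply/seteqP; split => x /=.
  by move=> Ax; rewrite -bigcap_seq => i _; exact: Ax.
by rewrite -bigcap_seq => Ax i; apply: Ax; rewrite /= mem_index_enum.
Qed.

Lemma lebesgueRn_box d (A : 'I_d -> set R) (r : 'I_d -> R) :
  (forall i, measurable (A i)) ->
  (forall i, lebesgue_measure (A i) = (r i)%:E) ->
  lebesgueRn R d (box A) = (\prod_(i < d) r i)%:E.
Proof.
elim: d A r => [|d IH] A r mA rA.
  by rewrite big_ord0 /= diracE mem_set// => -[].
rewrite big_ord_recl /= /lebesgue_cons /pushforward.
have -> : @cons_coord R d @^-1` box A = A ord0 `*` box (fun i => A (lift ord0 i)).
  apply/seteqP; split => -[x y] /=.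
    move=> Axy; split; first by have := Axy ord0; rewrite tnth0.
    by move=> i; have := Axy (lift ord0 i); rewrite tnthS.
  move=> [Ax Ay] i; have [j ->|->] := unliftP ord0 i; first by rewrite tnthS.
  by rewrite tnth0.
rewrite product_measure1E; last 2 first.
- exact: mA.
- by apply: measurable_box => i; exact: mA.
by rewrite EFinM -(rA ord0) -(IH (fun i => A (lift ord0 i))).
Qed.

End boxes.

Section euclidean_norm.
Context {R : realType} {d : nat}.
Implicit Types x y c : euclidean R d.

Lemma enorm_ge0 x : 0 <= enorm x.
Proof. exact: sqrtr_ge0. Qed.

Lemma enorm_sqr x : enorm x ^+ 2 = \sum_(i < d) tnth x i ^+ 2.
Proof. by rewrite sqr_sqrtr// sumr_ge0// => i _; rewrite sqr_ge0. Qed.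

Lemma norm_coord_le_enorm x i : `|tnth x i| <= enorm x.
Proof.
rewrite -sqrtr_sqr ler_sqrt; last by rewrite sumr_ge0// => j _; rewrite sqr_ge0.
by rewrite (bigD1 i)//= lerDl sumr_ge0// => j _; rewrite sqr_ge0.
Qed.

(** The Cauchy-Schwarz inequality, from the nonnegativity of the variance of
    the coordinates.  Through [enorm_le_coord] its factor [Num.sqrt d%:R] becomes
    the one in the parameter of the testing condition. *)
Lemma sum_norm_le_enorm x : \sum_(i < d) `|tnth x i| <= Num.sqrt d%:R * enorm x.
Proof.
set S := \sum_(i < d) _.
have S0 : 0 <= S by exact: sumr_ge0.
rewrite -(ler_pXn2r (n := 2)) ?nnegrE ?mulr_ge0 ?sqrtr_ge0 ?enorm_ge0//.
rewrite exprMn sqr_sqrtr ?ler0n// enorm_sqr.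
have [d0|d0] := posnP d.
  rewrite /S; rewrite big1 ?expr0n//= ?mulr_ge0//.
    by rewrite sumr_ge0// => j _; rewrite sqr_ge0.
  by move=> [j jd]; exfalso; rewrite d0 in jd.
have dR : 0 < d%:R :> R by rewrite ltr0n.
have : 0 <= \sum_(i < d) (`|tnth x i| - S / d%:R) ^+ 2.
  by rewrite sumr_ge0// => i _; rewrite sqr_ge0.
rewrite (eq_bigr (fun i : 'I_d => tnth x i ^+ 2 - 2 * (S / d%:R) * `|tnth x i| + (S / d%:R) ^+ 2)); last first.
  by move=> i _; rewrite -[tnth x i ^+ 2]real_normK ?num_real//; ring.
rewrite big_split/= sumrB -mulr_sumr -/S sumr_const card_ord -mulr_natl.
set N := \sum_(i < d) tnth x i ^+ 2.
rewrite (_ : _ + _ = N - S ^+ 2 / d%:R); last by field; rewrite gt_eqF.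
by rewrite subr_ge0 ler_pdivrMr// mulrC.
Qed.

(** The square of the right-hand side bounds the sum of the squares of
    [`|tnth y i| + h]: the mixed term is [sum_norm_le_enorm]. *)
Lemma enorm_le_coord x y (h : R) : 0 <= h ->
  (forall i, `|tnth x i - tnth y i| <= h) ->
  enorm x <= enorm y + Num.sqrt d%:R * h.
Proof.
move=> h0 xy.
have e0 := enorm_ge0 y; have s0 : 0 <= Num.sqrt d%:R :> R by exact: sqrtr_ge0.
rewrite -(ler_pXn2r (n := 2)) ?nnegrE ?addr_ge0 ?mulr_ge0 ?enorm_ge0//.
rewrite sqrrD !enorm_sqr exprMn sqr_sqrtr ?ler0n//.
apply: (@le_trans _ _ (\sum_(i < d) (tnth y i ^+ 2 + 2 * h * `|tnth y i| + h ^+ 2))).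
  apply: ler_sum => i _; rewrite -real_normK ?num_real// -[tnth y i ^+ 2]real_normK ?num_real//.
  have : `|tnth x i| <= `|tnth y i| + h.
    rewrite -[tnth x i](subrK (tnth y i)) addrC.
    by apply: le_trans (ler_normD _ _) _; rewrite lerD2l.
  have := normr_ge0 (tnth x i); have := normr_ge0 (tnth y i).
  by nra.
rewrite !big_split/= -mulr_sumr sumr_const card_ord -[_ *+ d]mulr_natl.
rewrite lerD2r lerD2l -mulr_natl.
have := ler_wpM2l h0 (sum_norm_le_enorm y); lra.
Qed.

Lemma norm_sqr_enorm_sub_le x y (h : R) :
  (forall i, `|tnth x i - tnth y i| <= h) ->
  `|enorm x ^+ 2 - enorm y ^+ 2| <= d%:R * (h * (2 * enorm y + h)).
Proof.
move=> xy; rewrite !enorm_sqr -sumrB.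
apply: le_trans (ler_norm_sum _ _ _) _.
have -> : d%:R * (h * (2 * enorm y + h)) = \sum_(i < d) (h * (2 * enorm y + h)).
  by rewrite sumr_const card_ord mulr_natl.
apply: ler_sum => i _.
rewrite subr_sqr normrM; apply: ler_pM => //.
rewrite (_ : tnth x i + tnth y i = 2 * tnth y i + (tnth x i - tnth y i)); last by ring.
apply: le_trans (ler_normD _ _) _; apply: lerD => //.
by rewrite normrM ger0_norm// ler_wpM2l// norm_coord_le_enorm.
Qed.

Lemma critical_radiusE c : critical_radius c = (Num.max 1 (enorm c))^-1.
Proof.
rewrite /critical_radius; case: ifPn => [/eqP ->|c0].
  by rewrite max_l// invr1.
have {}c0 : 0 < enorm c by rewrite lt_neqAle eq_sym c0 enorm_ge0.
have [c1|c1] := leP (enorm c) 1.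
  by rewrite min_l ?invr1// invf_ge1.
by rewrite min_r// invf_le1// ltW.
Qed.

Lemma le_mul_critical_radius (b l : R) c :
  (l <= b * critical_radius c) = (l * Num.max 1 (enorm c) <= b).
Proof.
by rewrite critical_radiusE ler_pdivlMr// lt_max ltr01.
Qed.

End euclidean_norm.

Section gaussian_of_sets.
Context {R : realType} {d : nat}.
Local Notation gamma := (@gaussian R d).
Local Notation lambda := (lebesgueRn R d).
Local Open Scope ereal_scope.

Lemma gaussian_null (A : set (euclidean R d)) : measurable A ->
  lambda A = 0 -> gamma A = 0.
Proof.
move=> mA A0; rewrite /gaussian.
rewrite (ge0_negligible_integral mA)//; last 2 first.
- apply/measurable_EFinP; apply: measurable_funS (@measurable_gauss_density R d) => //.
- by move=> x _; rewrite lee_fin gauss_density_ge0.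
by rewrite setDv integral_set0.
Qed.

Lemma gaussian_le (A : set (euclidean R d)) (M : R) : measurable A ->
  (forall x, A x -> (gauss_density x <= M)%R) -> gamma A <= M%:E * lambda A.
Proof.
move=> mA AM; rewrite /gaussian -integral_cst//.
by apply: ge0_le_integral_nomeas => x Ax; rewrite lee_fin ?gauss_density_ge0 ?AM.
Qed.

Lemma gaussian_ge (A : set (euclidean R d)) (M : R) : measurable A -> (0 <= M)%R ->
  (forall x, A x -> (M <= gauss_density x)%R) -> M%:E * lambda A <= gamma A.
Proof.
move=> mA M0 AM; rewrite /gaussian -integral_cst//.
by apply: ge0_le_integral_nomeas => x Ax; rewrite lee_fin ?AM.
Qed.

Lemma gauss_density_compare (x c : euclidean R d) (B : R) :
  (`|enorm x ^+ 2 - enorm c ^+ 2| <= B)%R ->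
  (expR (- B) * gauss_density c <= gauss_density x <= expR B * gauss_density c)%R.
Proof.
rewrite ler_norml => /andP[B1 B2]; rewrite /gauss_density.
apply/andP; split; [rewrite mulrCA|rewrite [leRHS]mulrCA];
  rewrite ler_wpM2l ?powR_ge0// -expRD ler_expR; lra.
Qed.

End gaussian_of_sets.

Section cubes.
Context {R : realType} {d : nat}.
Implicit Types (x y c : euclidean R d) (l : R).
Local Notation gamma := (@gaussian R d).
Local Notation lambda := (lebesgueRn R d).

Lemma cubeE c l : cube c l = box (fun i => `[tnth c i - l / 2, tnth c i + l / 2]%classic).
Proof.
apply/seteqP; split => y /= yc i; have := yc i; rewrite /= in_itv/= ler_distl//.
Qed.

Lemma measurable_cube c l : measurable (cube c l).
Proof. by rewrite cubeE; apply: measurable_box => i; exact: measurable_itv. Qed.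

Lemma lebesgueRn_cube c l : 0 <= l -> lambda (cube c l) = (l ^+ d)%:E.
Proof.
move=> l0; rewrite cubeE (@lebesgueRn_box _ _ _ (fun=> l)).
- by rewrite prodr_const card_ord.
- by move=> i; exact: measurable_itv.
- move=> i; rewrite lebesgue_measure_itv/= lte_fin; case: ifPn => h.
    by rewrite -EFinB; congr EFin; lra.
  by congr EFin; move: h; rewrite -leNgt; lra.
Qed.

Lemma cube_center c l : 0 <= l -> cube c l c.
Proof. by move=> l0 i; rewrite subrr normr0 divr_ge0. Qed.

Lemma gaussian_cube_bounds c l : 0 < l ->
  (0 < gamma (cube c l))%E /\ (gamma (cube c l) < +oo)%E.
Proof.
move=> l0; set B := d%:R * (l / 2 * (2 * enorm c + l / 2)).
have yB y : cube c l y -> `|enorm y ^+ 2 - enorm c ^+ 2| <= B.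
  by move=> yc; apply: norm_sqr_enorm_sub_le => i; exact: yc.
have g0 : 0 < gauss_density c by rewrite mulr_gt0 ?expR_gt0 ?powR_gt0 ?pi_gt0.
split.
  apply: lt_le_trans (@gaussian_ge _ _ _ (expR (- B) * gauss_density c) (measurable_cube c l) _ _).
  - rewrite lebesgueRn_cube ?(ltW l0)// -EFinM lte_fin.
    apply: mulr_gt0; last exact: exprn_gt0.
    by apply: mulr_gt0 => //; exact: expR_gt0.
  - by rewrite mulr_ge0 ?expR_ge0 ?gauss_density_ge0.
  - by move=> y /yB /gauss_density_compare/andP[].
apply: le_lt_trans (@gaussian_le _ _ _ (expR B * gauss_density c) (measurable_cube c l) _) _.
- by move=> y /yB /gauss_density_compare/andP[].
- by rewrite lebesgueRn_cube ?(ltW l0)// -EFinM ltry.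
Qed.

End cubes.

(** * The discrete cubes *)

Lemma measureD_eq0 (disp : measure_display) (T : measurableType disp)
    (R : realType) (mu : {measure set T -> \bar R}) (A B : set T) (r : R) :
  measurable A -> measurable B -> B `<=` A ->
  mu A = r%:E -> mu B = r%:E -> mu (A `\` B) = 0%E.
Proof.
move=> mA mB BA Ar Br.
have Afin : (mu A < +oo)%E by rewrite Ar ltry.
have -> : (mu (A `\` B) = mu A - mu (A `&` B))%E := measureD mA mB Afin.
by rewrite setIidr// Ar Br subee.
Qed.

Notation didx d := (nat * {ffun 'I_d -> int})%type.

Section dyadic.
Context {R : realType} {d : nat}.
Variable a : R.
Hypothesis a0 : 0 < a.
Local Notation gamma := (@gaussian R d).
Local Notation lambda := (lebesgueRn R d).

Implicit Types j : didx d.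

Definition mesh (k : nat) : R := a / 2 ^+ k.

Lemma mesh_gt0 k : 0 < mesh k.
Proof. by rewrite divr_gt0 ?exprn_gt0. Qed.

Lemma meshD k e : mesh k = mesh (k + e) * 2 ^+ e.
Proof. by rewrite /mesh exprD invfM mulrA divfK// expf_neq0. Qed.

(** The discrete cubes: three adjacent cells of the grid of mesh [a / 2 ^+ k] in
    each direction, starting at any cell.  A cube of side between one and two
    cells fits into one of them, whatever its position. *)
Definition dcube j : set (euclidean R d) :=
  box (fun i => `[mesh j.1 * (j.2 i)%:~R, mesh j.1 * (j.2 i + 3)%:~R[%classic).

Definition dcenter j : euclidean R d :=
  [tuple mesh j.1 * ((j.2 i)%:~R + 3 / 2) | i < d].

(** The closed cubes of the theorem overlap along their faces, whereas nesting
    needs half-open cubes.  The faces are null sets, so that the two versions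
    are interchangeable under integrals. *)
Definition dclosure j := cube (dcenter j) (3 * mesh j.1).

Lemma dcubeP j x : dcube j x <->
  forall i, mesh j.1 * (j.2 i)%:~R <= tnth x i < mesh j.1 * (j.2 i + 3)%:~R.
Proof. by split => h i; have := h i; rewrite /= in_itv. Qed.

Lemma measurable_dcube j : measurable (dcube j).
Proof. by apply: measurable_box => i; exact: measurable_itv. Qed.

Lemma measurable_dclosure j : measurable (dclosure j).
Proof. exact: measurable_cube. Qed.

Lemma dcube_sub_closure j : dcube j `<=` dclosure j.
Proof.
move=> x /dcubeP jx i; rewrite tnth_mktuple ler_distl.
by have := jx i; rewrite intrD => /andP[]; have := mesh_gt0 j.1; nra.
Qed.

Lemma lebesgueRn_dcube j : lambda (dcube j) = ((3 * mesh j.1) ^+ d)%:E.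
Proof.
rewrite (@lebesgueRn_box _ _ _ (fun=> 3 * mesh j.1)).
- by rewrite prodr_const card_ord.
- by move=> i; exact: measurable_itv.
- move=> i; rewrite lebesgue_measure_itv/= lte_fin ltr_pM2l ?mesh_gt0//.
  by rewrite ltr_int ltrDl/= -EFinB -mulrBr -intrB addrAC subrr add0r mulrC.
Qed.

Lemma gaussian_dcube_boundary j : gamma (dclosure j `\` dcube j) = 0%E.
Proof.
have m1 := measurable_dclosure j; have m2 := measurable_dcube j.
apply: gaussian_null; first exact: measurableD.
have l3 : 0 <= 3 * mesh j.1 by rewrite mulr_ge0// ltW// mesh_gt0.
apply: (measureD_eq0 (r := (3 * mesh j.1) ^+ d)) => //.
- exact: dcube_sub_closure.
- exact: lebesgueRn_cube.
- exact: lebesgueRn_dcube.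
Qed.

Lemma integral_dclosure j (f : euclidean R d -> \bar R) :
  measurable_fun setT f -> (forall x, 0 <= f x)%E ->
  (\int[gamma]_(x in dclosure j) f x = \int[gamma]_(x in dcube j) f x)%E.
Proof.
move=> mf f0.
have m1 := measurable_dclosure j; have m2 := measurable_dcube j.
rewrite (@ge0_negligible_integral _ _ _ _ _ (dclosure j `\` dcube j))//.
- by rewrite setDD setIidr//; exact: dcube_sub_closure.
- exact: measurableD.
- exact: measurable_funS mf.
- exact: gaussian_dcube_boundary.
Qed.

Lemma gaussian_dclosure j : gamma (dclosure j) = gamma (dcube j).
Proof.
have m1 := measurable_dclosure j; have m2 := measurable_dcube j.
by rewrite -[LHS]mul1e -[RHS]mul1e -!integral_cst// integral_dclosure.
Qed.

(** The discrete cubes split into finitely many grids, according to the residues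
    modulo 3 of their corners.  As 2 is [-1] modulo 3, the sign makes the residue
    independent of the mesh in which the corner is expressed. *)
Definition colour j : {ffun 'I_d -> 'F_3} :=
  [ffun i => (j.2 i)%:~R * (-1) ^+ j.1].

(** In the units of the finer mesh the two cubes have sides [3 * 2 ^+ e] and 3,
    and corners that are congruent modulo 3 in each direction.  Hence an
    interval of the small cube lies inside or outside that of the large one. *)
Lemma dcube_laminar j j' : colour j = colour j' ->
  [\/ dcube j `<=` dcube j', dcube j' `<=` dcube j | dcube j `&` dcube j' = set0].
Proof.
wlog : j j' / (j.1 <= j'.1)%N.
  move=> H jj'; have [le|/ltnW le] := leqP j.1 j'.1; first exact: H.
  have [?|?|] := H _ _ le (esym jj'); [by constructor 2|by constructor 1|].
  by rewrite setIC; constructor 3.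
case: j j' => [k m] [k' m'] /= kk'; rewrite -(subnKC kk').
move: (k' - k)%N => e {kk' k'} jj'.
pose M i : int := 2 ^+ e * m i.
have Mm i : exists c, M i = m' i + 3 * c.
  have /ffunP/(_ i) := jj'; rewrite !ffunE/= exprD mulrCA [RHS]mulrC.
  move=> /(mulIf _); rewrite signr_eq0 => /(_ isT) h.
  have : (3 %| (M i - m' i))%Z.
    rewrite (@dvdz_pcharf 'F_3 3)//.
    (* 2 = -1 modulo 3, hence [2 ^+ e * (-1) ^+ e = 1]. *)
    have two : 2%:~R = -1 :> 'F_3 by apply: val_inj.
    rewrite rmorphB rmorphM /= rmorphXn /= two h.
    by rewrite mulrCA -exprMn mulrNN mulr1 expr1n mulr1 subrr.
  by move=> /dvdzP[c cE]; exists c; rewrite mulrC -cE addrC subrK.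
have tri i : [\/ 2 ^+ e * 3 + M i <= m' i, m' i + 3 <= M i |
    M i <= m' i /\ m' i + 3 <= 2 ^+ e * 3 + M i].
  have [c ->] := Mm i.
  have : 0 < 2 ^+ e :> int by rewrite exprn_gt0.
  move: (2 ^+ e) (m' i) => E n E0.
  have [c0|c0] := leP 0 (- c); last by constructor 2; lia.
  have [cE|cE] := leP E (- c); first by constructor 1; lia.
  by constructor 3; split; lia.
have D0 := mesh_gt0 (k + e).
have dkE (z : int) : mesh k * z%:~R = mesh (k + e) * (2 ^+ e * z)%:~R.
  by rewrite (meshD k e) -mulrA intrM rmorphXn.
have jP x : dcube (k, m) x <-> forall i,
    mesh (k + e) * (M i)%:~R <= tnth x i < mesh (k + e) * (2 ^+ e * 3 + M i)%:~R.
  split.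
    by move=> /dcubeP h i; move: (h i) => /=; rewrite !dkE mulrDr addrC.
  by move=> h; apply/dcubeP => i /=; rewrite !dkE mulrDr addrC h.
have [[i hi]|] := pselect (exists i, 2 ^+ e * 3 + M i <= m' i \/ m' i + 3 <= M i).
  constructor 3; apply/seteqP; split => // x [/jP/(_ i)/andP[h1 h2] /dcubeP/(_ i)/andP[/= h3 h4]].
  case: hi => hi; [move: (le_lt_trans h3 h2)|move: (le_lt_trans h1 h4)];
    by rewrite ltr_pM2l// ltr_int ltNge hi.
move=> nex; constructor 2 => x /dcubeP xj; apply/jP => i.
have [h|h|[h1 h2]] := tri i.
- by exfalso; apply: nex; exists i; left.
- by exfalso; apply: nex; exists i; right.
have /= /andP[x1 x2] := xj i; apply/andP; split.
  by apply: le_trans x1; rewrite ler_pM2l// ler_int.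
by apply: lt_le_trans x2 _; rewrite ler_pM2l// ler_int.
Qed.

Lemma exists_mesh (l : R) : 0 < l -> l <= a -> exists k, mesh k <= l <= 2 * mesh k.
Proof.
move=> l0 la.
have ex : exists k, mesh k <= l.
  exists (Num.truncn (a / l)).+1; rewrite ler_pdivrMr ?exprn_gt0//.
  rewrite mulrC -ler_pdivrMr//; apply: le_trans (ltW (truncnS_gt _)) _.
  by rewrite -natrX ler_nat ltnW// ltn_expl.
case: (ex_minnP ex) => -[|k] kl kmin.
  exists 0%N; rewrite kl /mesh expr0 divr1; move: a0 la; lra.
exists k.+1; rewrite kl/= leNgt; apply/negP => lk.
have : (k.+1 <= k)%N; last by rewrite ltnn.
apply: kmin; rewrite ltW//; apply: le_lt_trans lk.
by rewrite (meshD k 1) addn1 expr1 mulrC.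
Qed.

(** The cell containing the lower corner is the first of the three. *)
Lemma cube_sub_dcube (c : euclidean R d) (l : R) : 0 < l -> l <= a ->
  exists2 j, cube c l `<=` dcube j & mesh j.1 <= l.
Proof.
move=> l0 la; have [k /andP[kl lk]] := exists_mesh l0 la.
have m0 := mesh_gt0 k.
exists (k, [ffun i => Num.floor ((tnth c i - l / 2) / mesh k)]) => //.
move=> x xc; apply/dcubeP => i /=; rewrite ffunE.
have := xc i; rewrite ler_distl => /andP[x1 x2].
set y := (tnth c i - l / 2) / mesh k.
have yE : tnth c i - l / 2 = mesh k * y by rewrite [mesh k * _]mulrC divfK// gt_eqF.
have := floor_le y; have := floorD1_gt y.
rewrite !intrD; move: ((Num.floor y)%:~R : R) => z h1 h2.
by apply/andP; split; nra.
Qed.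

End dyadic.

(** * Comparison of the local maximal function with discrete cubes *)

Section comparison.
Context {R : realType} {d : nat}.
Variable a : R.
Hypothesis a0 : 0 < a.
Local Notation gamma := (@gaussian R d).
Local Notation lambda := (lebesgueRn R d).
Local Notation b := (6 * a + 9 * Num.sqrt d%:R * a ^+ 2).
Implicit Types (c : euclidean R d) (j : didx d).

Lemma side_le (l : R) c : 0 < l -> l <= a * critical_radius c -> l <= a.
Proof.
move=> l0; rewrite le_mul_critical_radius => h; apply: le_trans h.
by rewrite ler_peMr ?(ltW l0)// le_max lexx.
Qed.

(** The discrete cube around a cube of side [l <= a * critical_radius c] has side
    at most [3 * l], and its center is at distance at most [3 / 2 * sqrt d * l]
    from [c].  So passing to its center enlarges [max 1 |c|] by at most
    [3 / 2 * sqrt d * a], and the side times this maximum is at most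
    [3 * a + 9 / 2 * sqrt d * a ^+ 2], half of the constant of the theorem. *)
Lemma dclosure_admissible c l j : 0 < l -> l <= a * critical_radius c ->
  cube c l `<=` dcube a j -> mesh a j.1 <= l ->
  admissible_cubes b (dclosure a j).
Proof.
move=> l0 lc cj ml; have la := side_le l0 lc.
have m0 := mesh_gt0 a0 j.1.
exists (dcenter a j), (3 * mesh a j.1); split => //; first by rewrite mulr_gt0.
rewrite le_mul_critical_radius.
have cc : cube (dcenter a j) (3 * mesh a j.1) c.
  by apply: (dcube_sub_closure a0); apply: cj; apply: cube_center; exact: ltW.
have s0 : 0 <= Num.sqrt d%:R :> R by exact: sqrtr_ge0.
have := @enorm_le_coord _ _ (dcenter a j) c (3 * mesh a j.1 / 2).
have h0 : 0 <= 3 * mesh a j.1 / 2 by rewrite !mulr_ge0// ltW.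
move=> /(_ h0); set X := enorm _; set Y := enorm _ => XY.
have {}XY : X <= Y + Num.sqrt d%:R * (3 * mesh a j.1 / 2).
  by apply: XY => i; rewrite distrC; exact: cc.
move: lc; rewrite le_mul_critical_radius -/Y => lc.
have Z : Num.max 1 X <= Num.max 1 Y + Num.sqrt d%:R * (3 * mesh a j.1 / 2).
  rewrite ge_max; apply/andP; split.
    apply: (@le_trans _ _ (Num.max 1 Y)); first by rewrite le_max lexx.
    by rewrite lerDl mulr_ge0.
  by apply: le_trans XY _; rewrite lerD2r le_max lexx orbT.
have M1 : 1 <= Num.max 1 Y by rewrite le_max lexx.
set m := mesh a j.1 in m0 ml Z *; set s := Num.sqrt _ in s0 Z *.
set M := Num.max 1 Y in lc Z M1.
have m2 : m * M <= a by apply: le_trans lc; rewrite ler_wpM2r// (le_trans _ M1).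
have m3 : s * m ^+ 2 <= s * a ^+ 2.
  by rewrite ler_wpM2l// lerXn2r ?nnegrE ?(ltW a0) ?(ltW m0)// (le_trans ml).
have := ler_wpM2l (ltW m0) Z; rewrite mulrDr => h.
have sa : 0 <= s * a ^+ 2 by rewrite mulr_ge0// sqr_ge0.
have e1 : m * (s * (3 * m / 2)) = (3 / 2) * (s * m ^+ 2) by field.
rewrite e1 in h.
rewrite -[9 * s * _]mulrA -[3 * m * _]mulrA; move: h m2 m3 sa a0.
move: (m * Num.max 1 X) (m * M) (s * m ^+ 2) (s * a ^+ 2) => ? ? ? ? /=; lra.
Qed.

(** The square of the factor by which the density varies around an admissible
    cube, times a bound for the ratio of the Lebesgue measures. *)
Definition doubling_const : R :=
  expR (d%:R * (6 * a + 9 * a ^+ 2)) ^+ 2 * 3 ^+ d.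

Lemma doubling_const_gt0 : 0 < doubling_const.
Proof. by rewrite mulr_gt0 ?exprn_gt0 ?expR_gt0. Qed.

(** The Gaussian measure is doubling on admissible cubes.  For [y] in the discrete
    cube the difference of [|y|^2] and [|c|^2] is of order [l * |c| + l^2], which
    is bounded since [l * max 1 |c| <= a]; so the density is comparable with
    its value at [c]. *)
Lemma gaussian_dcube_le c l j : 0 < l -> l <= a * critical_radius c ->
  cube c l `<=` dcube a j -> mesh a j.1 <= l ->
  (gamma (dcube a j) <= doubling_const%:E * gamma (cube c l))%E.
Proof.
move=> l0 lc cj ml; have la := side_le l0 lc.
have m0 := mesh_gt0 a0 j.1.
set B := d%:R * (6 * a + 9 * a ^+ 2).
have cc : dcube a j c by apply: cj; apply: cube_center; exact: ltW.
have dB y : dcube a j y -> `|enorm y ^+ 2 - enorm c ^+ 2| <= B.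
  move=> yj.
  have yc i : `|tnth y i - tnth c i| <= 3 * l.
    have /(dcubeP _ _) /(_ i) /andP[y1 y2] := yj.
    have /(dcubeP _ _) /(_ i) /andP[c1 c2] := cc.
    rewrite intrD mulrDr in y2 c2.
    by rewrite ler_norml; apply/andP; split; lra.
  apply: le_trans (norm_sqr_enorm_sub_le yc) _.
  rewrite ler_wpM2l//.
  have lc' : l * enorm c <= a.
    move: lc; rewrite le_mul_critical_radius; apply: le_trans.
    by rewrite ler_pM2l// le_max lexx orbT.
  have : l ^+ 2 <= a ^+ 2 by rewrite lerXn2r ?nnegrE ?(ltW a0) ?(ltW l0).
  nra.
have l00 := ltW l0.
have g0 := gauss_density_ge0 c.
have mQ := measurable_cube c l.
have mP := measurable_dcube a j.
have h1 : (gamma (dcube a j) <= (expR B * gauss_density c)%:E * lambda (dcube a j))%E.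
  by apply: gaussian_le => // y /dB /gauss_density_compare/andP[].
have h2 : ((expR (- B) * gauss_density c)%:E * lambda (cube c l) <= gamma (cube c l))%E.
  apply: gaussian_ge => //; first by rewrite mulr_ge0 ?expR_ge0.
  by move=> y /cj/dB /gauss_density_compare/andP[].
rewrite lebesgueRn_dcube// in h1; rewrite lebesgueRn_cube// in h2.
apply: le_trans h1 _.
apply: le_trans (_ : _ <= doubling_const%:E * ((expR (- B) * gauss_density c)%:E * (l ^+ d)%:E))%E _; last first.
  by rewrite lee_wpmul2l// lee_fin ltW// doubling_const_gt0.
rewrite -!EFinM lee_fin /doubling_const -/B exprMn.
rewrite (_ : expR B ^+ 2 * 3 ^+ d * (expR (- B) * gauss_density c * l ^+ d) =
   expR B * (expR B * expR (- B)) * gauss_density c * 3 ^+ d * l ^+ d); last by ring.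
rewrite -expRD subrr expR0 mulr1 mulrA ler_wpM2l//.
  by apply: mulr_ge0; [apply: mulr_ge0 => //; exact: expR_ge0|exact: exprn_ge0].
by rewrite lerXn2r ?nnegrE ?(ltW m0).
Qed.

End comparison.

Section maximal_bounds.
Context {R : realType} {d : nat}.
Variables (a alpha : R).
Hypothesis a0 : 0 < a.
Hypotheses (alpha0 : 0 <= alpha) (alphad : alpha < d%:R).
Local Notation gamma := (@gaussian R d).
Local Notation b := (6 * a + 9 * Num.sqrt d%:R * a ^+ 2).
Implicit Types (c x : euclidean R d) (j : didx d).

Definition frac_exponent : R := 1 - alpha / d%:R.

Lemma frac_exponent_gt0 : 0 < frac_exponent.
Proof.
have d0 : 0 < d%:R :> R by exact: le_lt_trans alphad.
by rewrite subr_gt0 ltr_pdivrMr// mul1r.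
Qed.

Definition frac_coef j : R := (fine (gamma (dcube a j)) `^ frac_exponent)^-1.

Lemma gaussian_dcube_bounds j :
  (0 < gamma (dcube a j))%E /\ (gamma (dcube a j) < +oo)%E.
Proof.
rewrite -gaussian_dclosure//; apply: gaussian_cube_bounds.
by rewrite mulr_gt0 ?mesh_gt0.
Qed.

Lemma frac_coef_gt0 j : 0 < frac_coef j.
Proof.
by rewrite invr_gt0 powR_gt0// fine_gt0//; apply/andP; exact: gaussian_dcube_bounds.
Qed.

Local Open Scope ereal_scope.

Lemma frac_coefE j : (gamma (dcube a j) `^ frac_exponent)^-1 = (frac_coef j)%:E.
Proof.
have [g0 gf] := gaussian_dcube_bounds j.
have gfin : gamma (dcube a j) \is a fin_num by rewrite ge0_fin_numE// ltW.
rewrite -(fineK gfin) poweR_EFin /inve gt_eqF// powR_gt0// fine_gt0//.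
by rewrite g0 gf.
Qed.

(** A discrete cube with admissible closure is a competitor in the supremum. *)
Lemma le_local_maximal j (beta : R) (h : euclidean R d -> \bar R) x :
  measurable_fun setT h ->
  admissible_cubes beta (dclosure a j) -> dcube a j x ->
  (frac_coef j)%:E * \int[gamma]_(y in dcube a j) `|h y| <=
  local_maximal alpha beta h x.
Proof.
move=> mh adm jx; apply: ereal_sup_ubound; exists (dclosure a j).
  by split => //; exact: dcube_sub_closure.
rewrite gaussian_dclosure// -/frac_exponent frac_coefE integral_dclosure//.
exact: measurableT_comp.
Qed.

(** Conversely every competitor is dominated by a discrete cube around it: the
    integral grows, and the Gaussian measures are comparable. *)
Lemma local_maximal_le (f : euclidean R d -> \bar R) x Q :
  measurable_fun setT f -> admissible_cubes_at a x Q ->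
  exists j, [/\ admissible_cubes b (dclosure a j), dcube a j x &
    (gamma Q `^ frac_exponent)^-1 * \int[gamma]_(y in Q) `|f y| <=
    (@doubling_const R d a `^ frac_exponent)%:E *
      ((frac_coef j)%:E * \int[gamma]_(y in dcube a j) `|f y|)].
Proof.
move=> mf [[c [l [l0 lc ->]]] /= cx].
have la := side_le l0 lc.
have [j cj ml] := cube_sub_dcube a0 c l0 la.
exists j; split; first exact: dclosure_admissible lc cj ml.
  exact: cj.
have [Q0 Qf] := gaussian_cube_bounds c l0.
have [P0 Pf] := gaussian_dcube_bounds j.
have PQ := gaussian_dcube_le a0 l0 lc cj ml.
have mQ := measurable_cube c l; have mP := measurable_dcube a j.
rewrite muleA; apply: lee_pmul.
- by rewrite inve_ge0 poweR_ge0.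
- by apply: integral_ge0.
- rewrite /frac_coef.
  have Pfin : gamma (dcube a j) \is a fin_num by rewrite ge0_fin_numE// ltW.
  have Qfin : gamma (cube c l) \is a fin_num by rewrite ge0_fin_numE// ltW.
  move: PQ; rewrite -(fineK Pfin) -(fineK Qfin).
  have fP : (0 < fine (gamma (dcube a j)))%R by rewrite fine_gt0// P0 Pf.
  have fQ : (0 < fine (gamma (cube c l)))%R by rewrite fine_gt0// Q0 Qf.
  rewrite /= /inve gt_eqF ?powR_gt0//.
  rewrite -!EFinM !lee_fin => PQ.
  have C0 := @doubling_const_gt0 R d a.
  rewrite ler_pdivlMr ?powR_gt0// mulrC ler_pdivrMr ?powR_gt0//.
  rewrite -powRM ?(ltW C0) ?(ltW fQ)// powR_le ?(ltW frac_exponent_gt0) ?(ltW fP)//.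
- apply: ge0_subset_integral => //.
  by apply: measurableT_comp => //; exact: measurable_funS mf.
Qed.

End maximal_bounds.

(** * The testing condition on discrete cubes *)

Section testing.
Context {R : realType} {d : nat}.
Variables (a p q alpha : R) (u v : euclidean R d -> R).
Hypotheses (a0 : 0 < a) (p1 : 1 < p) (pq : p <= q).
Hypotheses (meas_u : measurable_fun setT u) (mv : measurable_fun setT v).
Local Notation gamma := (@gaussian R d).
Local Notation b := (6 * a + 9 * Num.sqrt d%:R * a ^+ 2).
Hypothesis u0 : {ae gamma, forall x, 0 <= u x}.
Implicit Types (i j : didx d).

Let p0 : 0 < p. Proof. exact: lt_trans p1. Qed.
Let q0 : 0 < q. Proof. exact: lt_le_trans pq. Qed.

Local Open Scope ereal_scope.
Local Notation sigma A := (\int[gamma]_(x in A) dual_density p (v x)).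

Lemma measurable_dual_weight : measurable_fun setT (dual_weight p v).
Proof. exact: (measurable_dual_density_comp p mv). Qed.

(** The sets [E i] are disjoint, so at each point at most one summand survives.
    It is bounded by the power of the local maximal function of the dual weight
    restricted to the closure of [dcube a j], since [dcube a i] is one of the
    cubes in the supremum and lies inside that closure. *)
Lemma sum_testing_le (J : seq (didx d)) (E : didx d -> set (euclidean R d)) j :
  uniq J -> (forall i, i \in J -> admissible_cubes b (dclosure a i)) ->
  (forall i, measurable (E i)) -> (forall i, E i `<=` dcube a i) ->
  (forall i i' x, i \in J -> i' \in J -> E i x -> E i' x -> i = i') ->
  \sum_(i <- J | `[< dcube a i `<=` dcube a j >])
     ((frac_coef a alpha i)%:E * sigma (dcube a i)) `^ q *
       \int[gamma]_(x in E i) pospart u x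
  <= testing_left p q alpha b u v (dclosure a j) `^ q.
Proof.
move=> uJ admJ mE EP dE.
set Q := dclosure a j.
have mQ : measurable Q by exact: measurable_dclosure.
have mh : measurable_fun setT (fun y => dual_weight p v y * (\1_Q y)%:E).
  apply: emeasurable_funM; first exact: measurable_dual_weight.
  by apply/measurable_EFinP; exact: measurable_indic.
set M := local_maximal alpha b (fun y => dual_weight p v y * (\1_Q y)%:E).
pose c i := ((frac_coef a alpha i)%:E * sigma (dcube a i)) `^ q.
have c0 i : 0 <= c i by exact: poweR_ge0.
have mpu : measurable_fun setT (pospart u) by exact: measurable_pospart.
rewrite /testing_left poweRVK//; last first.
  rewrite -/M integral_mul_ae_ge0//; last by move=> x; exact: poweR_ge0.
  by apply: integral_ge0 => x _; rewrite mule_ge0 ?poweR_ge0 ?pospart_ge0.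
rewrite -/M integral_mul_ae_ge0//; last by move=> x; exact: poweR_ge0.
rewrite [leLHS](_ : _ = \sum_(i <- J | `[< dcube a i `<=` dcube a j >])
   \int[gamma]_(x in Q) (c i * (pospart u \_ (E i)) x)); last first.
  apply: eq_bigr => i /asboolP ij.
  rewrite ge0_integralZl//; last 2 first.
  - apply: measurable_funTS; apply/(measurable_restrictT _ (mE i)).
    exact: measurable_funS mpu.
  - by move=> x _; apply: erestrict_ge0 => y _; exact: pospart_ge0.
  rewrite -integral_mkcondr setIidr//.
  by apply: subset_trans (EP i) _; apply: subset_trans ij _; exact: dcube_sub_closure.
rewrite -big_filter -ge0_integral_sum//; last 2 first.
- move=> i; apply: measurable_funeM; apply: measurable_funTS.
  by apply/(measurable_restrictT _ (mE i)); exact: measurable_funS mpu.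
- move=> i x _; apply: mule_ge0 => //; apply: erestrict_ge0 => y _; exact: pospart_ge0.
apply: ge0_le_integral_nomeas => x Qx.
  apply: sume_ge0 => i _; apply: mule_ge0 => //.
  by apply: erestrict_ge0 => y _; exact: pospart_ge0.
set J' := [seq _ <- _ | _].
have J'J i : i \in J' -> i \in J by rewrite mem_filter => /andP[].
have [[i [iJ Ei]]|nE] := pselect (exists i, i \in J' /\ E i x); last first.
  rewrite big1_seq ?mule_ge0 ?poweR_ge0 ?pospart_ge0// => i /= iJ.
  by rewrite patchE memNset ?mule0// => Ei; apply: nE; exists i.
rewrite (big_rem i)//= [X in _ + X]big1_seq ?adde0; last first.
  move=> k; rewrite mem_rem_uniq ?filter_uniq// inE => /andP[_ /andP[ki kJ]].
  rewrite patchE memNset ?mule0// => Ek.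
  move/eqP: ki; apply; apply: (dE _ _ x) => //; exact: J'J.
rewrite patchE mem_set//; apply: lee_wpmul2r; first exact: pospart_ge0.
have sg0 A : 0 <= sigma A by apply: integral_ge0 => y _; exact/ltW/dual_density_gt0.
apply: poweR_le; first exact: ltW.
  by rewrite mule_ge0// lee_fin ltW// frac_coef_gt0.
have H := le_local_maximal alpha a0 mh (admJ _ (J'J _ iJ)) (EP _ _ Ei).
apply: le_trans H.
apply: lee_wpmul2l; first by rewrite lee_fin ltW// frac_coef_gt0.
rewrite le_eqVlt; apply/orP; left; apply/eqP; apply: eq_integral => y /set_mem iy.
move: iJ; rewrite mem_filter => /andP[/asboolP ij _].
rewrite indicE mem_set ?mule1; last by apply: (dcube_sub_closure a0); exact: ij.
by rewrite gee0_abs//; exact/ltW/dual_density_gt0.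
Qed.

Lemma sigma_dcube_gt0 j : 0 < sigma (dcube a j).
Proof.
have mP := measurable_dcube a j.
rewrite lt0e integral_ge0 ?andbT; last by move=> x _; exact/ltW/dual_density_gt0.
apply/eqP => s0.
have ms : measurable_fun (dcube a j) (dual_density p \o v).
  exact: measurable_funS (measurable_dual_density_comp p mv).
have [N [mN N0 sN]] : ae_eq gamma (dcube a j) (dual_density p \o v) (cst 0).
  apply/(ae_eq_integral_abs gamma mP ms).
  rewrite -[RHS]s0; apply: eq_integral => x _ /=.
  by rewrite gee0_abs//; exact/ltW/dual_density_gt0.
have [g0 _] := gaussian_dcube_bounds a0 j.
have : gamma (dcube a j) = 0.
  apply: (subset_measure0 mP mN _ N0) => x jx; apply: sN => /= h.
  by have := dual_density_gt0 p (v x); rewrite h// ltxx.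
by move=> e0; rewrite e0 ltxx in g0.
Qed.

(** A finite testing quotient has a finite numerator, and its denominator can be
    cleared when the dual mass is finite, being positive in any case. *)
Lemma local_testing_const : local_testing p q alpha b u v ->
  exists2 K : R, (0 <= K)%R & forall j, admissible_cubes b (dclosure a j) ->
   testing_left p q alpha b u v (dclosure a j) < +oo /\
   (sigma (dcube a j) < +oo ->
    testing_left p q alpha b u v (dclosure a j) `^ q <=
    (K `^ q)%:E * sigma (dcube a j) `^ (q / p)).
Proof.
rewrite /local_testing; set S := ereal_sup _ => Soo.
have [K K0 SK'] : exists2 K : R, (0 <= K)%R & S <= K%:E.
  move: Soo; case: S => [s _|//|_]; last by exists 0%R; rewrite ?leNye.
  exists (Num.max s 0)%R; first by rewrite le_max lexx orbT.
  by rewrite lee_fin le_max lexx.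
exists K => // j jadm.
have SK : testing_quotient p q alpha b u v (dclosure a j) <= K%:E.
  by apply: le_trans SK'; apply: ereal_sup_ubound; exists (dclosure a j).
move: SK; rewrite /testing_quotient; set L := testing_left _ _ _ _ _ _ _.
have L0 : 0 <= L by exact: poweR_ge0.
case: ifPn => [_|Loo]; first by rewrite leye_eq.
move=> LK; split; first by rewrite lt_neqAle Loo leey.
move=> soo; have s0 := sigma_dcube_gt0 j.
have sE : \int[gamma]_(x in dclosure a j) dual_weight p v x = sigma (dcube a j).
  rewrite integral_dclosure//; first exact: measurable_dual_weight.
  by move=> x; exact/ltW/dual_density_gt0.
move: LK; rewrite /testing_right sE => LK.
have sfin : sigma (dcube a j) \is a fin_num by rewrite ge0_fin_numE// ltW.
move: LK soo s0; rewrite -(fineK sfin); set s := fine _ => LK _ s0.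
rewrite lte_fin in s0.
have sp0 : (0 < s `^ p^-1)%R by rewrite powR_gt0.
move: LK; rewrite poweR_EFin /inve gt_eqF// lee_pdivrMr// => LK.
apply: le_trans (poweR_le (ltW q0) L0 LK) _.
by rewrite -EFinM !poweR_EFin powRM ?powR_ge0// -powRrM [(_ * q)%R]mulrC EFinM.
Qed.

(** If the dual weight has infinite mass on the cube, its local maximal function
    is infinite throughout the cube, while the left-hand side of the testing
    condition is finite.  The estimate [sum_testing_le] for the
    single set [dcube a j] expresses this. *)
Lemma sigma_infinite_weight_null j :
  local_testing p q alpha b u v -> admissible_cubes b (dclosure a j) ->
  sigma (dcube a j) = +oo -> \int[gamma]_(x in dcube a j) pospart u x = 0.
Proof.
move=> /local_testing_const[K K0 /(_ j)] + adm soo => /(_ adm)[Loo _].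
have := @sum_testing_le [:: j] (dcube a) j isT.
rewrite big_cons big_nil asboolT// adde0 soo gt0_muley ?lte_fin ?frac_coef_gt0//.
rewrite poweRyr ?gt_eqF// => H.
have {H} : +oo * \int[gamma]_(x in dcube a j) pospart u x <=
    testing_left p q alpha b u v (dclosure a j) `^ q.
  apply: H => //.
  - by move=> i; rewrite inE => /eqP ->.
  - by move=> i; exact: measurable_dcube.
  - by move=> i; exact: subset_refl.
  - by move=> i i' x; rewrite !inE => /eqP -> /eqP ->.
have : 0 <= \int[gamma]_(x in dcube a j) pospart u x.
  by apply: integral_ge0 => x _; exact: pospart_ge0.
rewrite le_eqVlt => /orP[/eqP //|U0]; rewrite gt0_mulye// leye_eq => /eqP.
move=> /poweR_eqy Ly; by rewrite Ly ltxx in Loo.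
Qed.

End testing.

(** * The two-weight inequality *)

Theorem theorem1p7 (R : realType) (d : nat) (a p q alpha : R)
    (u v : euclidean R d -> R) :
  0 < a -> 1 < p -> p <= q -> 0 <= alpha -> alpha < d%:R ->
  weight u -> weight v ->
  local_testing p q alpha (6 * a + 9 * Num.sqrt d%:R * a ^+ 2) u v ->
  exists2 C : R, 0 < C &
    forall f : euclidean R d -> R, LpW p v f ->
      ((\int[@gaussian R d]_x
          (local_maximal alpha a (EFin \o f) x `^ q * (u x)%:E)) `^ q^-1
       <= C%:E * (\int[@gaussian R d]_x (`|f x| `^ p * v x)%:E) `^ p^-1)%E.
Proof.
move=> a0 p1 pq alpha0 alphad [meas_u _ u0] [mv _ v0] test.
have p0 : 0 < p by exact: lt_trans p1.
have q0 : 0 < q by exact: lt_le_trans pq.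
have [K K0 HK] := local_testing_const a0 p1 pq mv test.
set b := 6 * a + _ in test HK.
pose D : R := (@doubling_const R d a `^ @frac_exponent R d alpha) `^ q.
pose Cc : R := 2 `^ q * K `^ q * level_const p `^ (q / p).
pose N : nat := #|{ffun 'I_d -> 'F_3}|.
pose C : R := (D * (N%:R * Cc)) `^ q^-1.
exists (C + 1); first by rewrite ltr_wpDl ?powR_ge0.
move=> f [mf ffin].
set X := (\int[_]_x _)%E in ffin *.
pose F x : R := `|f x|.
have mF : measurable_fun setT F by exact: measurableT_comp.
have F0 x : 0 <= F x by exact: normr_ge0.
have mpu := measurable_pospart meas_u.
have pu0 x : (0 <= pospart u x)%E by exact: pospart_ge0.
(* [cof j] is the [q]-th power of the average over [dcube a j]; the discrete
   maximal function of colour [g] runs over the admissible cubes of this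
   colour. *)
pose adm (j : didx d) : bool := `[< admissible_cubes b (dclosure a j) >].
pose cof (j : didx d) : \bar R :=
  (((frac_coef a alpha j)%:E * \int[@gaussian R d]_(x in dcube a j) (F x)%:E) `^ q)%E.
have cof0 j : (0 <= cof j)%E by exact: poweR_ge0.
have mdc j := @measurable_dcube R d a j.
pose A (g : {ffun 'I_d -> 'F_3}) : pred (didx d) := fun j => adm j && (colour j == g).
pose H g := countable_max (dcube a) cof (pospart u) (A g).
have H0 g x : (0 <= H g x)%E by exact: countable_max_ge0.
(* By monotone convergence it suffices to bound finite maxima, to which the
   testing inequality for laminar families applies. *)
have HB g : (\int[@gaussian R d]_x H g x <= Cc%:E * X `^ (q / p))%E.
  apply: integral_countable_max_le => // n.
  set J := initial_segment _ _.
  have JA j : j \in J -> admissible_cubes b (dclosure a j) /\ colour j = g.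
    by rewrite mem_filter => /andP[/andP[/asboolP ? /eqP ?] _].
  have [E [mE EP dE]] := integral_finite_max_le (@gaussian R d) mdc cof0 mpu pu0 J.
  move=> /le_trans; apply.
  apply: laminar_testing_inequality => //.
  - by move=> i j /JA[_ ig] /JA[_ jg]; apply: dcube_laminar => //; rewrite ig jg.
  - exact: powR_ge0.
  - by move=> i; apply/ltW/frac_coef_gt0.
  - by move=> i _; exact: sigma_dcube_gt0.
  - move=> i /JA[iadm _]; exact: sigma_infinite_weight_null test iadm.
  - move=> i /JA[iadm _] ioo; have [_ /(_ ioo)] := HK i iadm.
    apply: le_trans; apply: sum_testing_le => //.
      exact: uniq_initial_segment.
    by move=> k /JA[].
(* The local maximal function is dominated by the discrete ones; the maximum
   over the colours is at most the sum. *)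
have ptw x : (local_maximal alpha a (EFin \o f) x `^ q * pospart u x <=
    D%:E * \sum_g H g x)%E.
  have SH0 : (0 <= \sum_g H g x)%E by apply: sume_ge0 => g _; exact: H0.
  apply: ereal_sup_powR_mul_le => //.
  - by rewrite le_max lexx orbT.
  - move=> _ [Q _ <-]; apply: mule_ge0; last exact: integral_ge0.
    by rewrite inve_ge0 poweR_ge0.
  - by rewrite mule_ge0// lee_fin powR_ge0.
  move=> _ [Q Qx <-].
  have mfE : measurable_fun setT (EFin \o f) by exact/measurable_EFinP.
  have [j [jadm jx Qj]] := local_maximal_le a0 alpha0 alphad mfE Qx.
  set y := (_^-1 * _)%E; have y0 : (0 <= y)%E.
    by apply: mule_ge0; [rewrite inve_ge0 poweR_ge0|exact: integral_ge0].
  have Aj : A (colour j) j by rewrite /A eqxx andbT; exact/asboolP.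
  have yq : (y `^ q <= D%:E * cof j)%E.
    apply: le_trans (poweR_le (ltW q0) y0 Qj) _.
    rewrite poweRM ?lee_fin ?powR_ge0// mule_ge0 ?integral_ge0//.
    by rewrite lee_fin ltW// frac_coef_gt0.
  apply: le_trans (lee_wpmul2r (pu0 x) yq) _; rewrite -muleA.
  apply: lee_wpmul2l; first by rewrite lee_fin powR_ge0.
  have Hj : (cof j * pospart u x <= H (colour j) x)%E by exact: le_countable_max.
  apply: le_trans Hj _; rewrite (bigD1 (colour j))//=.
  by apply: leeDl; apply: sume_ge0 => g _; exact: H0.
have mH g : measurable_fun setT (H g) by exact: measurable_countable_max.
have main : (\int[@gaussian R d]_x (local_maximal alpha a (EFin \o f) x `^ q * (u x)%:E)
    <= (D * (N%:R * Cc))%:E * X `^ (q / p))%E.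
  rewrite integral_mul_ae_ge0//; last by move=> x; exact: poweR_ge0.
  apply: (@le_trans _ _ (\int[@gaussian R d]_x (D%:E * \sum_g H g x))%E).
    apply: ge0_le_integral_nomeas => x _; last exact: ptw.
    by rewrite mule_ge0 ?poweR_ge0.
  rewrite ge0_integralZl_EFin//; last 3 first.
  - by move=> x _; apply: sume_ge0 => g _; exact: H0.
  - exact: emeasurable_sum.
  - exact: powR_ge0.
  rewrite ge0_integral_sum// EFinM -muleA lee_wpmul2l ?lee_fin ?powR_ge0//.
  apply: le_trans (lee_sum _ (fun g _ => HB g)) _.
  rewrite sumr_const; set Z := (_ * _)%E.
  have -> : Z *+ #|{ffun 'I_d -> 'F_3}| = (N%:R%:E * Z)%E by rewrite mule_natl.
  by rewrite EFinM -muleA.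
have C0 : 0 <= D * (N%:R * Cc).
  by rewrite !mulr_ge0 ?powR_ge0 ?level_const_ge0.
apply: le_trans (poweR_le _ _ main) _.
- by rewrite invr_ge0 ltW.
- rewrite integral_mul_ae_ge0//; last by move=> x; exact: poweR_ge0.
  by apply: integral_ge0 => x _; rewrite mule_ge0 ?poweR_ge0.
rewrite poweRM ?poweR_ge0 ?lee_fin// -poweRrM.
rewrite mulrAC divff ?gt_eqF// mul1r lee_wpmul2r ?poweR_ge0//.
by rewrite lee_fin lerDl.
Qed.
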